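(* Let $H$ be an infinite-dimensional separable complex Hilbert space. Then there exists a complex linear subspace $Z$ with $\mathcal F(H)\subset Z\subset S_1(H)$ which is norm dense in $S_1(H)$ but is not invariant under the generalized Peirce projections of $S_1(H)$; that is, there exist a norm-exposed face $F$ of the unit ball of $S_1(H)$ and $k\in\{0,1,2\}$ such that $P_k(F)Z\not\subset Z$.
   Context: $\mathcal F(H)$ is the space of finite-rank operators on $H$, and $S_1(H)$ is the trace class with norm $\|x\|_1=\operatorname{Tr}(|x|)$. Let $X$ be a normed space with closed unit ball $X_1$ and dual $X^*$. Orthogonality: $f,g\in X$ are orthogonal, $f\diamond g$, if $\|f+g\|=\|f-g\|=\|f\|+\|g\|$. For $S\subset X$, $S^\diamond=\{f\in X: f\diamond g \text{ for every } g\in S\}$. A norm-exposed face of $X_1$ is a nonempty set of the form $F_u=\{f\in X_1: u(f)=1\}$ with $u\in X^*$, $\|u\|=1$. A norm-exposed face $F$ is symmetric if there is a surjective linear isometry $S_F:X\to X$ with $S_F^2=I$ and $\operatorname{Fix}(S_F)=\{x: S_Fx=x\}=\overline{\operatorname{sp}(F)}\oplus F^\diamond$, where $\overline{\operatorname{sp}(F)}$ is the norm-closed linear span of $F$ in $X$. Such $S_F$ is called a symmetry corresponding to $F$. It is known (Friedman–Russo) that every norm-exposed face of the unit ball of $S_1(H)$ is symmetric. The generalized Peirce projections of a symmetric face $F$ are $P_1(F)=\frac12(I-S_F)$ and the projections $P_2(F)$, $P_0(F)$ onto $\overline{\operatorname{sp}(F)}$ and $F^\diamond$ respectively, with $P_2(F)+P_0(F)=\frac12(I+S_F)$;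 thus $P_2(F)+P_1(F)+P_0(F)=I$, the decomposition being $X=\overline{\operatorname{sp}(F)}\oplus F^\diamond\oplus\ker(I+S_F)$. *)

(* Defs.v *)
From mathcomp Require Export all_boot all_order all_algebra.
From mathcomp Require Export sesquilinear complex.
From mathcomp Require Export all_classical all_reals all_analysis.
Export Order.TTheory GRing.Theory Num.Theory.
Export numFieldNormedType.Exports.

Set Implicit Arguments.
Unset Strict Implicit.
Unset Printing Implicit Defensive.

#[export] Set Implicit Arguments.
#[export] Unset Strict Implicit.
#[export] Unset Printing Implicit Defensive.

Local Open Scope classical_set_scope.
Local Open Scope complex_scope.
Local Open Scope ring_scope.

Section Linear.
Context {R : realType} {V : lmodType R[i]}.

Definition linear_subspace (W : set V) : Prop :=
  W 0 /\ forall (c : R[i]) x y, W x -> W y -> W (c *: x + y).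

Definition linear_span (A : set V) : set V :=
  [set x | exists (n : nat) (c : 'I_n -> R[i]) (a : 'I_n -> V),
     (forall i, A (a i)) /\ x = \sum_(i < n) c i *: a i].

Definition is_direct_sum (E U W : set V) : Prop :=
  [/\ linear_subspace U, linear_subspace W, U `&` W = [set 0] &
      E = [set u + w | u in U & w in W]].

Definition linear_on (X : set V) {V' : lmodType R[i]} (f : V -> V') : Prop :=
  forall (c : R[i]) x y, X x -> X y -> f (c *: x + y) = c *: f x + f y.

End Linear.

(* A normed space is given here as a linear subspace X of an ambient complex
   vector space V, with a norm N whose values outside X are irrelevant.
   Likewise maps on X are functions on V of which only the restriction to X
   matters. *)
Section NormedSpace.
Context {R : realType} {V : lmodType R[i]} (X : set V) (N : V -> R).

Definition unit_ball : set V := [set x | X x /\ N x <= 1].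

Definition norm_closure (A : set V) : set V :=
  [set x | X x /\ forall e : R, 0 < e -> exists2 y, A y & N (x - y) < e].

Definition dual_norm (u : V -> R[i]) : \bar R :=
  ereal_sup [set (complex.Re `|u x|)%:E | x in unit_ball].

Definition diamond (f g : V) : Prop :=
  N (f + g) = N (f - g) /\ N (f + g) = N f + N g.

Definition diamond_compl (A : set V) : set V :=
  [set f | X f /\ forall g, A g -> diamond f g].

Definition norm_exposed_face (F : set V) : Prop :=
  F !=set0 /\
  exists u : V -> R[i],
    [/\ linear_on X (u : V -> R[i]^o), dual_norm u = 1%E &
        F = [set f | unit_ball f /\ u f = 1]].

Definition closed_span (F : set V) : set V := norm_closure (linear_span F).

Definition is_symmetry (F : set V) (S : V -> V) : Prop :=
  [/\ linear_on X S,
      set_fun X X S /\ set_surj X X S,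
      (forall x, X x -> N (S x) = N x),
      (forall x, X x -> S (S x) = x) &
      is_direct_sum [set x | X x /\ S x = x] (closed_span F) (diamond_compl F)].

Definition is_projection_onto (U : set V) (P : V -> V) : Prop :=
  [/\ linear_on X P, P @` X = U & forall x, X x -> P (P x) = P x].

(* P k, for k = 0, 1, 2, is the generalized Peirce projection P_k(F). *)
Definition peirce_projections (F : set V) (P : nat -> V -> V) : Prop :=
  exists2 S : V -> V, is_symmetry F S &
    [/\ forall x, X x -> P 1%N x = 2^-1 *: (x - S x),
        is_projection_onto (closed_span F) (P 2%N),
        is_projection_onto (diamond_compl F) (P 0%N) &
        forall x, X x -> P 2%N x + P 0%N x = 2^-1 *: (x + S x)].

End NormedSpace.

Definition separable (T : topologicalType) : Prop :=
  exists2 A : set T, countable A & dense A.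

Definition infinite_dimensional (R : realType) (V : lmodType R[i]) : Prop :=
  ~ exists (n : nat) (b : 'I_n -> V), linear_span (range b) = [set: V].

(* H is a Hilbert space for the inner product dot, which is linear in its
   first argument. *)
Section Operators.
Context {R : realType} {H : completeNormedModType R[i]}.

Definition bounded_operator (T : H -> H) : Prop := linear T /\ continuous T.

Definition finite_rank : set (H -> H) :=
  [set T | bounded_operator T /\
     exists (n : nat) (b : 'I_n -> H), range T `<=` linear_span (range b)].

Context (dot : {dot H for (@Num.conj R[i])}).

Definition positive_operator (a : H -> H) : Prop :=
  bounded_operator a /\ forall v, 0 <= dot (a v) v.

(* The last condition says a^2 = x^* x. *)
Definition is_abs (x a : H -> H) : Prop :=
  positive_operator a /\ forall v w, dot (a (a v)) w = dot (x v) (x w).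

(* Every bounded x has exactly one such a. *)
Definition abs_op (x : H -> H) : H -> H := xget 0 [set a | is_abs x a].

Definition orthonormal_basis (e : nat -> H) : Prop :=
  (forall i j, dot (e i) (e j) = (i == j)%:R) /\ dense (linear_span (range e)).

(* On positive operators, the value does not depend on the basis. A basis
   indexed by nat exists as soon as H is separable and infinite-dimensional. *)
Definition trace (a : H -> H) : \bar R :=
  let e := xget (fun=> 0) [set e | orthonormal_basis e] in
  (\sum_(0 <= n <oo) (complex.Re (dot (a (e n)) (e n)))%:E)%E.

Definition trace_class : set (H -> H) :=
  [set x | bounded_operator x /\ (trace (abs_op x) < +oo)%E].

Definition trace_norm (x : H -> H) : R := fine (trace (abs_op x)).

End Operators.

(* Main.v *)
From HB Require Import structures.
Require Import Defs.
From mathcomp Require Import ring lra.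

(** Let [e] be the orthonormal basis that computes the trace, [v] the isometry
    [e i |-> e (2 i)], [P = v v^*], and [F] the face of the unit ball of the
    trace class exposed by [u x = Tr (v^* x) = sum_i <x (e i), v (e i)>].  Its
    closed span is the set of the [x] with [P x = x], its orthogonal complement
    is [0], and [x |-> (2 P - 1) x] is a symmetry: it does not change [x^* x],
    hence not [|x|].  For any symmetry, the first Peirce projection must be
    [x |-> (1 - P) x].  Take [Z] spanned by the finite-rank operators and by
    the diagonal operator [x] with [x (e i) = 2 ^ -(i + 1) e i]: no combination
    [(1 - P) x - c x] has finite rank.

    The trace norm is handled by duality with contractions: by the polar
    decomposition, [Tr |x|] is the supremum of [Re (sum_(i < n) <x (e i), c (e i)>)]
    over the contractions [c] and the [n], in the fixed basis [e]. *)

(** An isometry is used because [v^* v = 1] leaves no room on the right: the zero space of the face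
    vanishes and the Peirce decomposition reduces to [x = P x + (1 - P) x]. Doubling the indices
    makes both [P] and [1 - P] of infinite rank. On the even basis vectors [(1 - P) x - c x] has the
    eigenvalues [- c 2 ^ -(2 i + 1)], on the odd ones [(1 - c) 2 ^ -(2 i + 2)], and no [c] kills
    both families.

    Two obstacles shape the rest. The trace norm is defined through [|x|], which is not additive in
    [x]; pairings with contractions are linear, so subadditivity, tail estimates and perturbation
    arguments are all carried out on them. And the definition of a symmetry prescribes only its
    fixed space: the eigenspace for [-1], hence the first Peirce projection, has to be recovered
    from the fact that the symmetry is isometric.

    Square roots and polar parts are strong limits of polynomials in a positive contraction, with
    scalar or moment sequences controlling the convergence. *)

Local Open Scope classical_set_scope.
Local Open Scope complex_scope.
Local Open Scope ring_scope.

(** * Real modulus and real part of complex scalars *)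

Section ComplexScalars.
Context {R : realType}.
Implicit Types z w : R[i].

(* [`|z|] and [`|x|] are elements of [R[i]]; [cabs] and [nr] below are their
   real values. *)
Definition cabs z : R := complex.Re `|z|.

Lemma cabsE z : (cabs z)%:C = `|z|.
Proof. by rewrite /cabs normc_def. Qed.

Lemma Re_le_cabs z : complex.Re z <= cabs z.
Proof.
by rewrite -lecR cabsE (le_trans _ (normc_ge_Re z)) // lecR ler_norm.
Qed.

Lemma cabs_ge0 z : 0 <= cabs z.
Proof. by rewrite -lecR cabsE normr_ge0. Qed.

Lemma cabsM z w : cabs (z * w) = cabs z * cabs w.
Proof. by apply: complexI; rewrite rmorphM /= !cabsE normrM. Qed.

Lemma cabsD z w : cabs (z + w) <= cabs z + cabs w.
Proof. by rewrite -lecR rmorphD /= !cabsE ler_normD. Qed.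

Lemma cabs_eq0 z : cabs z = 0 -> z = 0.
Proof. by move=> h; apply/normr0_eq0; rewrite -cabsE h. Qed.

Lemma cabs_conj z : cabs z^* = cabs z.
Proof. by rewrite /cabs normcJ. Qed.

Lemma conjE z : Num.conj z = z^*%C.
Proof. by []. Qed.

Lemma cabsN z : cabs (- z) = cabs z.
Proof. by apply: complexI; rewrite !cabsE normrN. Qed.

Lemma cabs0 : cabs (0 : R[i]) = 0.
Proof. by apply: complexI; rewrite cabsE normr0. Qed.

Lemma cabs1 : cabs (1 : R[i]) = 1.
Proof. by apply: complexI; rewrite cabsE normr1. Qed.

Lemma cabs_real (x : R) : cabs x%:C = `|x|.
Proof.
by apply: complexI; rewrite cabsE normc_def /= expr0n addr0 sqrtr_sqr.
Qed.

Lemma cabs_sum (I : Type) (r : seq I) (P : pred I) (f : I -> R[i]) :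
  cabs (\sum_(i <- r | P i) f i) <= \sum_(i <- r | P i) cabs (f i).
Proof.
elim/big_ind2: _ => //; first by rewrite cabs0.
by move=> x a y b h h'; rewrite (le_trans (cabsD _ _)) // lerD.
Qed.

Lemma conj_Re z : complex.Re z^* = complex.Re z.
Proof. by case: z. Qed.

Lemma mul_conj z : z * z^* = (cabs z ^+ 2)%:C.
Proof. by rewrite rmorphXn /= cabsE sqr_normc. Qed.

Lemma ReD z w : complex.Re (z + w) = complex.Re z + complex.Re w.
Proof. by case: z w => [? ?] []. Qed.

Lemma ReN z : complex.Re (- z) = - complex.Re z.
Proof. by case: z. Qed.

Lemma ReM (a : R) z : complex.Re (a%:C * z) = a * complex.Re z.
Proof. by case: z => ? ?; rewrite /= mul0r subr0. Qed.

Lemma Re_sum (I : Type) (r : seq I) (P : pred I) (f : I -> R[i]) :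
  complex.Re (\sum_(i <- r | P i) f i) = \sum_(i <- r | P i) complex.Re (f i).
Proof. by elim/big_ind2: _ => // x a y b <- <-; rewrite ReD. Qed.

(** A rotation by [c] turns a bound on real parts that is stable under rotations into a bound on the
    modulus. *)
Lemma phase z : exists c : R[i], cabs c = 1 /\ c * z = (cabs z)%:C.
Proof.
have [->|z0] := eqVneq z 0.
  by exists 1; rewrite cabs1 mulr0 cabs0.
exists ((cabs z)^-1%:C * z^*%C).
have n0 : cabs z != 0 by apply/eqP => /cabs_eq0/eqP; rewrite (negbTE z0).
split.
  by rewrite cabsM cabs_conj cabs_real ger0_norm ?invr_ge0 ?cabs_ge0// mulVf.
by rewrite -mulrA [_ * z]mulrC mul_conj -rmorphM /= expr2 mulrA mulVf // mul1r.
Qed.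

End ComplexScalars.

(** * Inner product, real-valued norm and limits *)

Section Hilbert.
Context {R : realType} {H : completeNormedModType R[i]}.
Variable dot : {dot H for (@Num.conj R[i])}.
Hypothesis dotE : forall x : H, `|x| ^+ 2 = dot x x.
Implicit Types (x y z : H) (c : R[i]).

Lemma dotDl x y z : dot (x + y) z = dot x z + dot y z.
Proof. exact: linearDl. Qed.
Lemma dotDr x y z : dot x (y + z) = dot x y + dot x z.
Proof. exact: linearDr. Qed.
Lemma dotNl x y : dot (- x) y = - dot x y.
Proof. exact: linearNl. Qed.
Lemma dotNr x y : dot x (- y) = - dot x y.
Proof. exact: linearNr. Qed.
Lemma dotBl x y z : dot (x - y) z = dot x z - dot y z.
Proof. exact: linearBl. Qed.
Lemma dotBr x y z : dot x (y - z) = dot x y - dot x z.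
Proof. exact: linearBr. Qed.
Lemma dotZl c x y : dot (c *: x) y = c * dot x y.
Proof. exact: linearZl_LR. Qed.
Lemma dotZr c x y : dot x (c *: y) = c^* * dot x y.
Proof. exact: linearZr_LR. Qed.
Lemma dotC x y : dot x y = (dot y x)^*.
Proof. by rewrite hermC expr0 mul1r. Qed.
Lemma dot0l y : dot 0 y = 0.
Proof. exact: linear0l. Qed.
Lemma dot0r y : dot y 0 = 0.
Proof. exact: linear0r. Qed.
Lemma dot_suml (I : Type) (r : seq I) (P : pred I) (f : I -> H) y :
  dot (\sum_(i <- r | P i) f i) y = \sum_(i <- r | P i) dot (f i) y.
Proof.
by apply: (big_morph (fun x => dot x y)) => [u v|]; rewrite ?dotDl ?dot0l.
Qed.
Lemma dot_sumr (I : Type) (r : seq I) (P : pred I) (f : I -> H) y :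
  dot y (\sum_(i <- r | P i) f i) = \sum_(i <- r | P i) dot y (f i).
Proof. by apply: (big_morph (dot y)) => [u v|]; rewrite ?dotDr ?dot0r. Qed.

Definition nr x : R := complex.Re `|x|.

Lemma nrE x : (nr x)%:C = `|x|.
Proof. by rewrite /nr RRe_real // ger0_real. Qed.

Lemma nr_ge0 x : 0 <= nr x.
Proof. by rewrite -lecR nrE normr_ge0. Qed.
Lemma nrD x y : nr (x + y) <= nr x + nr y.
Proof. by rewrite -lecR rmorphD /= !nrE ler_normD. Qed.
Lemma nrN x : nr (- x) = nr x.
Proof. by rewrite /nr normrN. Qed.
Lemma nrB x y : nr (x - y) <= nr x + nr y.
Proof. by rewrite -(nrN y) nrD. Qed.
Lemma nrC x y : nr (x - y) = nr (y - x).
Proof. by rewrite -nrN opprB. Qed.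
Lemma nrZ c x : nr (c *: x) = cabs c * nr x.
Proof. by apply: complexI; rewrite rmorphM /= cabsE !nrE normrZ. Qed.
Lemma nr0 : nr 0 = 0.
Proof. by rewrite /nr normr0. Qed.
Lemma nr_eq0 x : nr x = 0 -> x = 0.
Proof. by move=> h; apply/normr0_eq0; rewrite -nrE h. Qed.
Lemma nr_gt0 x : x != 0 -> 0 < nr x.
Proof.
move=> x0; rewrite lt_def nr_ge0 andbT; apply: contra x0 => /eqP/nr_eq0 ->//.
Qed.

Lemma dotxx x : dot x x = (nr x ^+ 2)%:C.
Proof. by rewrite -dotE rmorphXn /= nrE. Qed.
Lemma nr_sqr x : nr x ^+ 2 = complex.Re (dot x x).
Proof. by rewrite dotxx. Qed.

Lemma dotC_Re x y : complex.Re (dot y x) = complex.Re (dot x y).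
Proof. by rewrite dotC conj_Re. Qed.

Lemma nrD_sqr x y :
  nr (x + y) ^+ 2 = nr x ^+ 2 + nr y ^+ 2 + 2 * complex.Re (dot x y).
Proof.
rewrite !nr_sqr dotDl !dotDr !ReD (dotC_Re x y); ring.
Qed.

Lemma nrB_sqr x y :
  nr (x - y) ^+ 2 = nr x ^+ 2 + nr y ^+ 2 - 2 * complex.Re (dot x y).
Proof. by rewrite nrD_sqr nrN dotNr ReN mulrN. Qed.

Lemma cauchy_schwarz x y : cabs (dot x y) <= nr x * nr y.
Proof.
have [->|y0] := eqVneq y 0; first by rewrite dot0r cabs0 nr0 mulr0.
have p := nr_gt0 y0.
have [c [c1 cE]] := phase (dot x y).
(* Once [x] is rotated so that the inner product is real, [|<x, y>| / |y|^2] is the coefficient of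
   its projection on [y]. *)
have := sqr_ge0 (nr (c *: x - (cabs (dot x y) / nr y ^+ 2)%:C *: y)).
rewrite nrB_sqr dotZl dotZr conjE conjc_real mulrCA cE -rmorphM /=.
rewrite !nrZ c1 mul1r cabs_real ger0_norm ?divr_ge0 ?cabs_ge0 ?sqr_ge0 //.
have -> : nr x ^+ 2 + (cabs (dot x y) / nr y ^+ 2 * nr y) ^+ 2 -
  2 * (cabs (dot x y) / nr y ^+ 2 * cabs (dot x y)) =
  (nr x ^+ 2 * nr y ^+ 2 - cabs (dot x y) ^+ 2) / nr y ^+ 2.
  by field; rewrite gt_eqF.
rewrite pmulr_lge0 ?invr_gt0 ?exprn_gt0 // subr_ge0 -exprMn => h.
by rewrite -ler_sqr ?nnegrE ?mulr_ge0 ?nr_ge0 ?cabs_ge0.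
Qed.

Lemma dot_eq x y : (forall z, dot x z = dot y z) -> x = y.
Proof.
move=> h; apply/subr0_eq/nr_eq0/eqP; rewrite -sqrf_eq0 nr_sqr dotBl h subrr.
by [].
Qed.

(** Balls of [H] have radii in [R[i]], where a positive element is real; this moves convergence in
    [H] to real sequences. *)
Lemma cvg_nrP (s : nat -> H) (l : H) :
  s @ \oo --> l <-> (fun n => nr (s n - l)) @ \oo --> (0 : R).
Proof.
split=> [/cvgrPdist_lt|/cvgrPdist_lt] h.
  apply/cvgrPdist_lt => e e0; have := h e%:C; rewrite ltcR => /(_ e0).
  apply: filterS => n; rewrite -nrE ltcR => hn.
  by rewrite sub0r normrN ger0_norm ?nr_ge0 // nrC.
apply/cvgrPdist_lt => -[a b]; rewrite ltcE /= => /andP[/eqP -> a0].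
have := h a a0; apply: filterS => n.
by rewrite -nrE sub0r normrN ger0_norm ?nr_ge0 // nrC complexr0 ltcR.
Qed.

Lemma cvg_nr_le (s : nat -> H) (l : H) (v : nat -> R) :
  (forall n, nr (s n - l) <= v n) -> v @ \oo --> (0 : R) -> s @ \oo --> l.
Proof.
move=> h hv; apply/cvg_nrP.
apply: (squeeze_cvgr _ (cvg_cst 0) hv).
by apply: nearW => n; rewrite nr_ge0 h.
Qed.

Lemma cauchy_cvgH (s : nat -> H) :
  (forall e : R, 0 < e -> exists N, forall m n, (N <= m)%N -> (N <= n)%N ->
      nr (s m - s n) < e) -> exists l : H, s @ \oo --> l.
Proof.
move=> h; apply/cvg_ex.
apply/cauchy_cvgP/cauchy_exP => -[a b]; rewrite ltcE /= => /andP[/eqP -> a0].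
have [N hN] := h a a0.
exists (s N) => /=; exists N => // n /= Nn.
by rewrite -ball_normE /= -nrE complexr0 ltcR hN.
Qed.

Lemma dense_approx (A : set H) z (d : R) : dense A -> 0 < d ->
  exists2 y, A y & nr (z - y) < d.
Proof.
move=> hA d0.
have [|y [/= hy Ay]] := hA (ball z d%:C) _ (ball_open z d%:C).
  by exists z; apply: ballxx; rewrite ltcR.
by exists y => //; move: hy; rewrite -ball_normE /= -nrE ltcR.
Qed.

Lemma nr_cvg (s : nat -> H) (l : H) : s @ \oo --> l -> (nr \o s) @ \oo --> nr l.
Proof.
move=> /cvg_nrP h; apply/subr_cvg0; apply/norm_cvg0P.
apply: (squeeze_cvgr _ (cvg_cst 0) h); apply: nearW => n.
rewrite normr_ge0 /= ler_norml; apply/andP; split.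
  by rewrite lerNl opprB lerBlDr nrC (le_trans _ (nrD _ _)) // subrK.
by rewrite lerBlDr (le_trans _ (nrD _ _)) // subrK.
Qed.

Lemma dot_cvg (s t : nat -> H) (l m : H) :
  s @ \oo --> l -> t @ \oo --> m -> 
  (fun n => dot (s n) (t n)) @ \oo --> (dot l m : R[i]^o).
Proof.
move=> sl tm.
(* This sequence dominates [|<s n, t n> - <l, m>|], by inserting [<l, t n>] and using Cauchy-Schwarz
   twice. *)
have key : (fun n => nr (s n - l) * nr (t n) + nr l * nr (t n - m)) @ \oo
    --> (0 : R).
  rewrite -[X in _ --> X](addr0 0); apply: cvgD.
    rewrite -[X in _ --> X](mul0r (nr m)); apply: cvgM; first exact/cvg_nrP.
    exact: nr_cvg.
  rewrite -[X in _ --> X](mulr0 (nr l)); apply: cvgM; first exact: cvg_cst.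
  exact/cvg_nrP.
apply/cvgrPdist_lt => -[a b]; rewrite ltcE /= => /andP[/eqP -> a0].
move/cvgrPdist_lt: key => /(_ a a0); apply: filterS => n.
rewrite sub0r normrN -cabsE complexr0 ltcR => /(le_lt_trans _); apply.
rewrite (le_trans _ (ler_norm _)) //.
have -> : dot l m - dot (s n) (t n) = - (dot (s n - l) (t n) + dot l (t n - m)).
  by rewrite dotBl dotBr; ring.
by rewrite cabsN (le_trans (cabsD _ _)) // lerD // cauchy_schwarz.
Qed.

Lemma dot_cvgl (s : nat -> H) (l : H) y : s @ \oo --> l ->
  (fun n => dot (s n) y) @ \oo --> (dot l y : R[i]^o).
Proof. by move=> h; apply: dot_cvg => //; exact: cvg_cst. Qed.

Lemma dot_cvgr (s : nat -> H) (l : H) y : s @ \oo --> l ->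
  (fun n => dot y (s n)) @ \oo --> (dot y l : R[i]^o).
Proof. by move=> h; apply: dot_cvg => //; exact: cvg_cst. Qed.

Lemma cvgH_unique (s : nat -> H) (l m : H) : s @ \oo --> l -> s @ \oo --> m -> l = m.
Proof. by move=> h h'; apply: (cvg_unique _ h h'). Qed.

Lemma cvgC_unique (s : nat -> R[i]^o) (l m : R[i]) :
  s @ \oo --> (l : R[i]^o) -> s @ \oo --> (m : R[i]^o) -> l = m.
Proof. by move=> h h'; apply: (@cvg_unique R[i]^o _ _ _ _ _ h h'). Qed.

Lemma Re_cvg (s : nat -> R[i]^o) (l : R[i]^o) : s @ \oo --> (l : R[i]^o) ->
  (fun n => complex.Re (s n)) @ \oo --> complex.Re l.
Proof.
move=> /cvgrPdist_lt h; apply/cvgrPdist_lt => e e0.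
have := h e%:C; rewrite ltcR => /(_ e0); apply: filterS => n.
rewrite -cabsE ltcR; apply: le_lt_trans.
rewrite -ReN -ReD -cabs_real; rewrite cabs_real ler_norml Re_le_cabs andbT.
by rewrite lerNl -ReN (le_trans (Re_le_cabs _)) // cabsN.
Qed.

End Hilbert.
Arguments dot_cvgl {R H dot} dotE {s l} y _.
Arguments dot_cvgr {R H dot} dotE {s l} y _.

(** * Bounded operators and orthonormal sequences *)

(** Supplies the Cauchy estimates for orthogonal series, for the square-root iteration and for the
    powers of a positive contraction. *)
Lemma nondecreasing_cauchy (R : realType) (u : nat -> R) (K : R) :
  (forall n, u n <= u n.+1) -> (forall n, u n <= K) ->
  forall e : R, 0 < e -> exists N, forall m n, (N <= m)%N -> (N <= n)%N ->
    `|u m - u n| < e.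
Proof.
move=> mono bnd e e0.
have /cvg_ex[l] : cvgn u.
  apply: nondecreasing_is_cvgn; first exact/nondecreasing_seqP.
  by exists K => _ [n _ <-].
move=> /cvgrPdist_lt /(_ (e / 2)); rewrite divr_gt0 // => /(_ isT) [N _ hN].
exists N => m n Nm Nn; have := hN m Nm; have := hN n Nn => /= h1 h2.
rewrite (_ : u m - u n = (l - u n) - (l - u m)); last by ring.
by rewrite (le_lt_trans (ler_normB _ _)) // (splitr e) ltrD.
Qed.

Section BoundedOperators.
Context {R : realType} {H : completeNormedModType R[i]}.
Implicit Types (T : H -> H) (M : R).

Section LinearMaps.
Variables (T : H -> H) (hT : linear T).
Lemma lin0 : T 0 = 0.
Proof. by have := hT (-1) 0 0; rewrite scaler0 addr0 scaleN1r addNr. Qed.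
Lemma linD x y : T (x + y) = T x + T y.
Proof. by have := hT 1 x y; rewrite !scale1r. Qed.
Lemma linZ c x : T (c *: x) = c *: T x.
Proof. by have := hT c x 0; rewrite lin0 !addr0. Qed.
Lemma linN x : T (- x) = - T x.
Proof. by rewrite -scaleN1r linZ scaleN1r. Qed.
Lemma linB x y : T (x - y) = T x - T y.
Proof. by rewrite linD linN. Qed.
Lemma lin_sum (I : Type) (r : seq I) (P : pred I) (f : I -> H) :
  T (\sum_(i <- r | P i) f i) = \sum_(i <- r | P i) T (f i).
Proof. by apply: (big_morph T) => [u v|]; rewrite ?linD ?lin0. Qed.
End LinearMaps.

(** Quantitative form of [bounded_operator]: with the bound explicit, a contraction is [bop 1] and
    uniform bounds pass to strong limits. *)
Definition bop M T := linear T /\ forall z, nr (T z) <= M * nr z.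

Lemma bop_le M M' T : M <= M' -> bop M T -> bop M' T.
Proof.
move=> MM' [lT h]; split=> // z.
by rewrite (le_trans (h z)) // ler_wpM2r // nr_ge0.
Qed.

Lemma bop_comp M M' T T' : 0 <= M -> bop M T -> bop M' T' ->
  bop (M * M') (T \o T').
Proof.
move=> M0 [lT h] [lT' h']; split; first by move=> c x y /=; rewrite lT' lT.
by move=> z /=; rewrite (le_trans (h _)) // -mulrA ler_wpM2l.
Qed.

Lemma bopD M M' T T' : bop M T -> bop M' T' -> bop (M + M') (T + T').
Proof.
move=> [lT h] [lT' h']; split.
  move=> c x y; rewrite -[LHS]/(T _ + T' _) lT lT'.
  by rewrite -[(T + T') x]/(T x + T' x) scalerDr addrACA.
by move=> z; rewrite mulrDl (le_trans (nrD _ _)) // lerD.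
Qed.

Lemma bopZ M c T : bop M T -> bop (cabs c * M) (c *: T).
Proof.
move=> [lT h]; split.
  move=> d x y; rewrite -[LHS]/(c *: T _) lT scalerDr !scalerA mulrC.
  by rewrite -scalerA.
by move=> z; rewrite nrZ -mulrA ler_wpM2l // cabs_ge0.
Qed.

Lemma bop_id : bop 1 id.
Proof. by split=> // z; rewrite mul1r. Qed.

Lemma bop0 : bop 0 (0 : H -> H).
Proof.
split=> [c x y|z]; first by rewrite -[RHS]/(c *: 0 + 0) scaler0 addr0.
by rewrite mul0r -[_ z]/0 nr0.
Qed.

Lemma bop_cvg M T (s : nat -> H) (l : H) : bop M T ->
  s @ \oo --> l -> (T \o s) @ \oo --> T l.
Proof.
move=> [lT h] /cvg_nrP sl.
apply: (@cvg_nr_le _ _ _ _ (fun n => M * nr (s n - l))).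
  by move=> n /=; rewrite -linB.
by rewrite -[X in _ --> X](mulr0 M); apply: cvgM => //; exact: cvg_cst.
Qed.

Lemma bounded_operatorP T :
  bounded_operator T <-> exists2 M, 0 < M & bop M T.
Proof.
split=> [[lT cT]|[M M0 [lT h]]]; last first.
  split=> // x; apply/cvgrPdist_lt => -[a b].
  rewrite ltcE /= => /andP[/eqP -> a0].
  have d0 : 0 < (a / M)%:C :> R[i] by rewrite ltcR divr_gt0.
  have /cvgrPdist_lt/(_ _ d0) : id @ x --> x by exact: cvg_id.
  apply: filterS => y /=; rewrite -!nrE -linB // complexr0 !ltcR => hy.
  by rewrite (le_lt_trans (h _)) // mulrC -ltr_pdivlMr.
pose Tl := HB.pack_for {linear H -> H} T (GRing.isLinear.Build _ _ _ _ T lT).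
have /linear_boundedP : bounded_near Tl (nbhs 0).
  by apply/linear_bounded_continuous => x; exact: cT.
move=> /pinfty_ex_gt0 [[M M'] M0 hM].
move: M0 hM; rewrite ltcE /= => /andP[/eqP -> M0] hM.
exists M => //; split=> // z.
by rewrite -lecR rmorphM /= !nrE; exact: hM.
Qed.

(** The way operators are built below: diagonal operators, adjoints, square roots and polar parts
    are all pointwise limits with a common bound. *)
Lemma strong_limit M (A : nat -> H -> H) : (forall n, bop M (A n)) ->
  (forall z, exists l : H, (A ^~ z) @ \oo --> l) ->
  exists2 T, bop M T & forall z, (A ^~ z) @ \oo --> T z.
Proof.
move=> hA /boolp.choice[T hT]; exists T => //; split.
  move=> c x y; apply: (cvgH_unique (hT _)).
  rewrite (_ : A ^~ _ = fun n => c *: A n x + A n y); last first.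
    by apply: funext => n; rewrite (hA n).1.
  apply: cvgD; last exact: hT.
  by apply: cvgZ; [exact: cvg_cst|exact: hT].
move=> z; apply: (ler_cvg_to (nr_cvg (hT z)) (cvg_cst _)).
by apply: nearW => n; exact: (hA n).2.
Qed.

End BoundedOperators.

(** * Orthonormal expansions, diagonal operators and adjoints *)

Section Orthonormal.
Context {R : realType} {H : completeNormedModType R[i]}.
Variable dot : {dot H for (@Num.conj R[i])}.
Hypothesis dotE : forall x : H, `|x| ^+ 2 = dot x x.

Definition orthonormal_seq (f : nat -> H) :=
  forall i j, dot (f i) (f j) = (i == j)%:R.

Lemma nr_orthonormal f : orthonormal_seq f -> forall i, nr (f i) = 1.
Proof.
move=> fo i; apply/eqP.
by rewrite -(@eqrXn2 _ 2) ?nr_ge0 // (nr_sqr dotE) fo eqxx expr1n.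
Qed.

Lemma dot_sum_orthonormal f (c : nat -> R[i]) m n j : orthonormal_seq f ->
  dot (\sum_(m <= i < n) c i *: f i) (f j) = if (m <= j < n)%N then c j else 0.
Proof.
move=> fo; rewrite (dot_suml dot).
have [h|h] := boolP (m <= j < n)%N.
  rewrite (bigD1_seq j) ?mem_index_iota ?iota_uniq //= (dotZl dot) fo eqxx mulr1.
  rewrite big1 ?addr0 // => i /negbTE ij.
  by rewrite (dotZl dot) fo ij mulr0.
rewrite big_nat big1 // => i hi; rewrite (dotZl dot) fo.
have [ij|_] := eqVneq i j; last by rewrite mulr0.
by rewrite -ij hi in h.
Qed.

Lemma nr_sum_orthonormal f (c : nat -> R[i]) m n : orthonormal_seq f ->
  nr (\sum_(m <= i < n) c i *: f i) ^+ 2 = \sum_(m <= i < n) cabs (c i) ^+ 2.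
Proof.
move=> fo; rewrite (nr_sqr dotE) (dot_sumr dot) Re_sum big_nat [RHS]big_nat.
apply: eq_bigr => i hi; rewrite (dotZr dot) dot_sum_orthonormal // hi.
by rewrite mulrC mul_conj.
Qed.

Lemma dot_proj f z m n : orthonormal_seq f ->
  dot z (\sum_(m <= i < n) dot z (f i) *: f i) =
  (\sum_(m <= i < n) cabs (dot z (f i)) ^+ 2)%:C.
Proof.
move=> fo; rewrite (dot_sumr dot) rmorph_sum /=; apply: eq_bigr => i _.
by rewrite (dotZr dot) mulrC mul_conj.
Qed.

(** The partial sum [p] satisfies [|p|^2 = <z, p> <= |z| |p|], and [|p|] cancels. *)
Lemma nr_proj f z m n : orthonormal_seq f ->
  nr (\sum_(m <= i < n) dot z (f i) *: f i) <= nr z.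
Proof.
move=> fo; set p := (X in nr X <= _).
have : nr p ^+ 2 <= nr z * nr p.
  rewrite (nr_sum_orthonormal _ _ _ fo).
  apply: le_trans (cauchy_schwarz dotE z p).
  by rewrite dot_proj // cabs_real ler_norm.
have [->|/nr_gt0 p0] := eqVneq p 0; first by rewrite nr0 nr_ge0.
by rewrite expr2 ler_pM2r.
Qed.

Lemma bessel f z m n : orthonormal_seq f ->
  \sum_(m <= i < n) cabs (dot z (f i)) ^+ 2 <= nr z ^+ 2.
Proof.
move=> fo; rewrite -(nr_sum_orthonormal _ _ _ fo).
by rewrite ler_sqr ?nnegrE ?nr_ge0 // nr_proj.
Qed.

(** Differences of partial sums have as squared norms the tails of a bounded nondecreasing
    sequence. *)
Lemma riesz_fischer f (c : nat -> R[i]) (K : R) : orthonormal_seq f ->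
  (forall n, \sum_(0 <= i < n) cabs (c i) ^+ 2 <= K) ->
  exists l : H, (fun n => \sum_(0 <= i < n) c i *: f i) @ \oo --> l.
Proof.
move=> fo hK; apply: cauchy_cvgH => e e0.
have mono n : \sum_(0 <= i < n) cabs (c i) ^+ 2 <=
    \sum_(0 <= i < n.+1) cabs (c i) ^+ 2.
  by rewrite big_nat_recr //= lerDl sqr_ge0.
have [N hN] := nondecreasing_cauchy mono hK (exprn_gt0 2 e0).
have main m n : (N <= n)%N -> (n <= m)%N ->
    nr (\sum_(0 <= i < m) c i *: f i - \sum_(0 <= i < n) c i *: f i) < e.
  move=> Nn nm; rewrite (big_cat_nat (leq0n n) nm) //= addrAC subrr add0r.
  rewrite -ltr_sqr ?nnegrE ?nr_ge0 ?(ltW e0) // (nr_sum_orthonormal _ _ _ fo).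
  apply: le_lt_trans (hN m n (leq_trans Nn nm) Nn).
  rewrite (big_cat_nat (leq0n n) nm) //= addrAC subrr add0r ler_norm //.
exists N => m n Nm Nn.
by have [nm|mn] := leqP n m; [|rewrite nrC]; apply: main => //; exact: ltnW.
Qed.

Section Basis.
Variable e : nat -> H.
Hypothesis he : orthonormal_basis dot e.

Let eo : orthonormal_seq e := he.1.

(** [z] is orthogonal to a dense span, so [|z|^2 = <z, z - y> <= |z| |z - y|] for [y] in the span
    and arbitrarily close to [z]. *)
Lemma basis_orth z : (forall i, dot z (e i) = 0) -> z = 0.
Proof.
move=> h; apply: nr_eq0; apply/eqP; rewrite eq_le nr_ge0 andbT.
have hs y : linear_span (range e) y -> dot z y = 0.
  move=> [n [c [a [ha ->]]]]; rewrite (dot_sumr dot) big1 // => i _.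
  by have [j _ <-] := ha i; rewrite (dotZr dot) h mulr0.
apply/ler_addgt0Pr => d d0; rewrite add0r.
have [y /hs y0 hy] := dense_approx z he.2 d0.
have [->|z0] := eqVneq z 0; first by rewrite nr0 ltW.
rewrite -(ler_pM2l (nr_gt0 z0)) -expr2 (nr_sqr dotE) -[dot z z]subr0 -y0.
rewrite -(dotBr dot) (le_trans (Re_le_cabs _)) //.
by rewrite (le_trans (cauchy_schwarz dotE _ _)) // ler_wpM2l ?nr_ge0 // ltW.
Qed.

Lemma basis_ext x y : (forall i, dot x (e i) = dot y (e i)) -> x = y.
Proof.
move=> h; apply/subr0_eq/basis_orth => i; by rewrite (dotBl dot) h subrr.
Qed.

Lemma cvg_dot_sum (c : nat -> R[i]) (l : H) j :
  (fun n => \sum_(0 <= i < n) c i *: e i) @ \oo --> l -> dot l (e j) = c j.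
Proof.
move=> h; apply: (cvgC_unique (dot_cvgl dotE (e j) h)).
apply: cvg_near_cst; exists j.+1 => // n /= jn.
by rewrite dot_sum_orthonormal // jn.
Qed.

(** The orthogonal projection onto the span of the first [m] basis vectors; [x \o bproj m] is the
    finite-rank truncation of [x]. *)
Definition bproj m z := \sum_(0 <= i < m) dot z (e i) *: e i.

(** Bessel and Riesz-Fischer give some limit; it has the same coefficients as [z], hence equals
    [z]. *)
Lemma cvg_bproj z : (bproj ^~ z) @ \oo --> z.
Proof.
have [l hl] := riesz_fischer eo (fun n => bessel z 0 n eo).
suff E : z = l by rewrite -E in hl.
by apply: basis_ext => i; rewrite (cvg_dot_sum i hl).
Qed.

Lemma bop_bproj m : bop 1 (bproj m).
Proof.
split=> [c x y|z]; last by rewrite mul1r nr_proj.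
rewrite /bproj scaler_sumr -big_split /=; apply: eq_bigr => i _.
by rewrite (dotDl dot) (dotZl dot) scalerDl scalerA.
Qed.

Lemma bop_ext M M' T T' : bop M T -> bop M' T' ->
  (forall i, T (e i) = T' (e i)) -> T = T'.
Proof.
move=> hT hT' h; apply: funext => z.
apply: (cvgH_unique (bop_cvg hT (@cvg_bproj z))).
rewrite (_ : _ \o _ = T' \o (bproj ^~ z)); first exact: (bop_cvg hT' (@cvg_bproj z)).
apply: funext => n /=; rewrite /bproj (lin_sum hT.1) (lin_sum hT'.1).
by apply: eq_bigr => i _; rewrite (linZ hT.1) (linZ hT'.1) h.
Qed.

(** Source of the isometry [v] (all [d i = 1]) and of the weighted operators. Bessel bounds the
    partial sums because [|d i| <= 1]. *)
Lemma diag_exists f (d : nat -> R[i]) : orthonormal_seq f ->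
  (forall i, cabs (d i) <= 1) ->
  exists2 T, bop 1 T & forall i, T (e i) = d i *: f i.
Proof.
move=> fo hd.
pose A n z := \sum_(0 <= i < n) (d i * dot z (e i)) *: f i.
have le i z : cabs (d i * dot z (e i)) <= cabs (dot z (e i)).
  by rewrite cabsM ler_piMl ?cabs_ge0.
have [|z|T hT AT] := @strong_limit R H 1 A.
- move=> n; split=> [c x y|z].
    rewrite /A scaler_sumr -big_split /=; apply: eq_bigr => i _.
    rewrite (dotDl dot) (dotZl dot) mulrDr scalerDl scalerA.
    by congr (_ *: _ + _); ring.
  rewrite mul1r -ler_sqr ?nnegrE ?nr_ge0 // (nr_sum_orthonormal _ _ _ fo).
  apply: le_trans (bessel z 0 n eo); apply: ler_sum => i _.
  by rewrite ler_sqr ?nnegrE ?cabs_ge0.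
- apply: (@riesz_fischer _ _ (nr z ^+ 2) fo) => n.
  apply: le_trans (bessel z 0 n eo); apply: ler_sum => i _.
  by rewrite ler_sqr ?nnegrE ?cabs_ge0.
exists T => // j; apply: (cvgH_unique (AT (e j))).
apply: cvg_near_cst; exists j.+1 => // n /= jn.
rewrite /A (bigD1_seq j) ?mem_index_iota ?iota_uniq //= eo eqxx mulr1.
by rewrite big1 ?addr0 // => i /negbTE ij; rewrite eo eq_sym ij mulr0 scale0r.
Qed.

Lemma dot_ext M M' S T : bop M S -> bop M' T ->
  (forall i w, dot (S (e i)) w = dot (e i) (T w)) ->
  forall v w, dot (S v) w = dot v (T w).
Proof.
move=> hS hT h v w.
apply: (cvgC_unique (dot_cvgl dotE w (bop_cvg hS (@cvg_bproj v)))).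
rewrite (_ : (fun n => _) = fun n => dot (bproj n v) (T w)).
  exact/(dot_cvgl dotE)/cvg_bproj.
apply: funext => n /=; rewrite /bproj (lin_sum hS.1) !(dot_suml dot).
by apply: eq_bigr => i _; rewrite (linZ hS.1) !(dotZl dot) h.
Qed.

(** [S w] is the vector with coefficients [<w, T (e i)>]. Its partial sums [A n w] satisfy
    [|A n w|^2 = <w, T (A n w)>], so they are bounded by [M |w|] uniformly in [n]. *)
Lemma adjoint_exists M T : 0 <= M -> bop M T ->
  exists2 S, bop M S & forall v w, dot (T v) w = dot v (S w).
Proof.
move=> M0 hT; pose A n w := \sum_(0 <= i < n) dot w (T (e i)) *: e i.
have bA n w : nr (A n w) <= M * nr w.
  have E : (nr (A n w) ^+ 2)%:C = dot w (T (A n w)).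
    rewrite (nr_sum_orthonormal _ _ _ eo) (lin_sum hT.1) (dot_sumr dot).
    rewrite rmorph_sum /=; apply: eq_bigr => i _.
    by rewrite (linZ hT.1) (dotZr dot) mulrC mul_conj.
  have : nr (A n w) ^+ 2 <= M * nr w * nr (A n w).
    rewrite -[X in X <= _]ger0_norm ?sqr_ge0 // -cabs_real E.
    rewrite (le_trans (cauchy_schwarz dotE _ _)) // mulrAC mulrC.
    by rewrite ler_wpM2r ?nr_ge0 // hT.2.
  have [->|/nr_gt0 p0] := eqVneq (A n w) 0.
    by rewrite nr0 mulr_ge0 ?nr_ge0.
  by rewrite expr2 ler_pM2r.
have [|w|S hS AS] := @strong_limit R H M A.
- move=> n; split=> [c x y|//].
  rewrite /A scaler_sumr -big_split /=; apply: eq_bigr => i _.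
  by rewrite (dotDl dot) (dotZl dot) scalerDl scalerA.
- apply: (@riesz_fischer _ _ ((M * nr w) ^+ 2) eo) => n.
  rewrite -(nr_sum_orthonormal _ _ _ eo) ler_sqr ?nnegrE ?mulr_ge0 ?nr_ge0 //.
  exact: bA.
exists S => //; apply: (dot_ext hT hS) => i w.
by rewrite (dotC dot) -(cvg_dot_sum i (AS w)) -(dotC dot).
Qed.

End Basis.
End Orthonormal.
Arguments cvg_bproj {R H dot} dotE {e} he z.

(** * Existence of an orthonormal basis *)

Section Span.
Context {R : realType} {V : lmodType R[i]}.
Implicit Types (A W : set V).

Lemma linear_span_subspace A : linear_subspace (linear_span A).
Proof.
split; first by exists 0%N, (fun=> 0), (fun=> 0); split; [case|rewrite big_ord0].
move=> c x y [m [a [f [fA ->]]]] [n [b [g [gA ->]]]].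
exists (m + n)%N.
exists (fun i => match fintype.split i with inl j => c * a j | inr j => b j end).
exists (fun i => match fintype.split i with inl j => f j | inr j => g j end).
split; first by move=> i; case: fintype.split.
rewrite big_split_ord /= scaler_sumr; congr (_ + _); apply: eq_bigr => i _.
  by rewrite (unsplitK (inl i)) scalerA.
by rewrite (unsplitK (inr i)).
Qed.

Lemma sub_linear_span A : A `<=` linear_span A.
Proof.
move=> x Ax; exists 1%N, (fun=> 1), (fun=> x); split=> //.
by rewrite big_ord1 scale1r.
Qed.

Section Subspace.
Variables (W : set V) (hW : linear_subspace W).

Lemma subspaceZ c x : W x -> W (c *: x).
Proof. by move=> Wx; rewrite -[_ *: _]addr0; apply: hW.2 => //; exact: hW.1. Qed.

Lemma subspaceD x y : W x -> W y -> W (x + y).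
Proof. by move=> Wx Wy; rewrite -[x]scale1r; apply: hW.2. Qed.

Lemma subspaceB x y : W x -> W y -> W (x - y).
Proof. by move=> Wx Wy; rewrite -scaleN1r; apply: subspaceD => //; exact: subspaceZ. Qed.

Lemma subspace_sum (I : Type) (r : seq I) (P : pred I) (f : I -> V) :
  (forall i, P i -> W (f i)) -> W (\sum_(i <- r | P i) f i).
Proof.
by move=> h; elim/big_ind: _ => //; [exact: hW.1|exact: subspaceD].
Qed.

Lemma linear_span_sub A : A `<=` W -> linear_span A `<=` W.
Proof.
move=> AW x [n [c [a [ha ->]]]]; apply: subspace_sum => i _.
by apply: subspaceZ; exact: AW.
Qed.
End Subspace.

(** The [n + 1] coefficient rows form a matrix with [n] columns, whose left kernel is nonzero. *)
Lemma span_dependent (n : nat) (b : 'I_n -> V) (f : nat -> V) :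
  (forall i, linear_span (range b) (f i)) ->
  exists c : 'I_n.+1 -> R[i], (exists i, c i != 0) /\
    \sum_(i < n.+1) c i *: f i = 0.
Proof.
move=> hf.
have /boolp.choice[M hM] (i : nat) :
    exists r : 'rV[R[i]]_n, f i = \sum_(j < n) r ord0 j *: b j.
  suff : linear_subspace [set x | exists r : 'rV[R[i]]_n,
      x = \sum_(j < n) r ord0 j *: b j] /\
    range b `<=` [set x | exists r : 'rV[R[i]]_n, x = \sum_(j < n) r ord0 j *: b j].
    by move=> [s1 s2]; exact: (linear_span_sub s1 s2 (hf i)).
  split.
    split; first by exists 0; rewrite big1 // => j _; rewrite mxE scale0r.
    move=> c x y [r ->] [s ->]; exists (c *: r + s).
    rewrite scaler_sumr -big_split /=; apply: eq_bigr => j _.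
    by rewrite !mxE scalerDl scalerA.
  move=> _ [j _ <-]; exists (delta_mx ord0 j).
  rewrite (bigD1 j) //= mxE !eqxx scale1r big1 ?addr0 // => k /negbTE kj.
  by rewrite mxE kj andbF scale0r.
pose N : 'M[R[i]]_(n.+1, n) := \matrix_(i, j) M i ord0 j.
have : kermx N != 0.
  by rewrite -mxrank_eq0 mxrank_ker subn_eq0 -ltnNge ltnS rank_leq_col.
case/rowV0Pn => v /sub_kermxP vN v0.
exists (fun i => v ord0 i); split.
  apply: contra_neqP v0 => h; apply/rowP => i; rewrite mxE.
  by apply: contrapT => /eqP vi; apply: h; exists i.
under eq_bigr do rewrite hM scaler_sumr.
rewrite exchange_big big1 //= => j _.
under eq_bigr do rewrite scalerA.
rewrite -scaler_suml.
suff -> : \sum_(i < n.+1) v ord0 i * M i ord0 j = 0 by rewrite scale0r.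
have := congr1 (fun A : 'rV_n => A ord0 j) vN; rewrite [RHS]mxE mxE => h.
by rewrite -[RHS]h; apply: eq_bigr => i _; rewrite mxE.
Qed.

End Span.

(** * Gram-Schmidt orthonormalization of a dense sequence *)

Section GramSchmidt.
Context {R : realType} {H : completeNormedModType R[i]}.
Variable dot : {dot H for (@Num.conj R[i])}.
Hypothesis dotE : forall x : H, `|x| ^+ 2 = dot x x.

Definition residual (l : seq H) z := z - \sum_(x <- l) dot z x *: x.

Lemma bop_residual l : bop (1 + \sum_(x <- l) nr x ^+ 2) (residual l).
Proof.
split=> [c x y|z].
  rewrite /residual scalerBr -addrACA; congr (_ + _).
  rewrite -opprD; congr (- _); rewrite scaler_sumr -big_split /=.
  by apply: eq_bigr => u _; rewrite (dotDl dot) (dotZl dot) scalerDl scalerA.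
rewrite mulrDl mul1r (le_trans (nrB _ _)) // lerD2l.
elim: l => [|x l IH]; first by rewrite !big_nil nr0 mul0r.
rewrite !big_cons mulrDl (le_trans (nrD _ _)) // lerD //.
rewrite nrZ expr2 mulrAC ler_wpM2r ?nr_ge0 //.
by rewrite mulrC cauchy_schwarz.
Qed.

Lemma bop_dense_eq0 (A : set H) M T : dense A -> bop M T ->
  (forall x, A x -> T x = 0) -> forall z, T z = 0.
Proof.
move=> hA hT h z; apply: nr_eq0; apply/eqP; rewrite eq_le nr_ge0 andbT.
apply/ler_addgt0Pr => d d0; rewrite add0r.
have M1 : 0 < `|M| + 1 by rewrite ltr_wpDl.
have [y Ay zy] := dense_approx z hA (divr_gt0 d0 M1).
rewrite -[T z]subr0 -(h _ Ay) -(linB hT.1) (le_trans (hT.2 _)) //.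
rewrite (le_trans (y := (`|M| + 1) * nr (z - y))) //.
  by rewrite ler_wpM2r ?nr_ge0 // ler_wpDr // ler_norm.
by rewrite mulrC -ler_pdivlMr // ltW.
Qed.

Lemma countable_range (A : set H) : countable A ->
  exists d : nat -> H, A `<=` range d.
Proof.
move=> /countable_injP[f finj].
exists (fun n => xget 0 [set x | A x /\ f x = n]) => x Ax.
exists (f x) => //; case: xgetP => [y _ [Ay fy]|/(_ x)[]//].
by apply: finj => //; exact: mem_set.
Qed.

Hypotheses (sepH : separable H) (infH : infinite_dimensional H).

Lemma orthonormal_basis_exists : exists e : nat -> H, orthonormal_basis dot e.
Proof.
have [A cA dA] := sepH; have [d hd] := countable_range cA.
(* If the residual of [l] vanished at every [d k], it would vanish on a dense set, hence everywhere,
   and [l] would span [H]. *)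
have hres l : exists k, residual l (d k) != 0.
  apply: contrapT => h; apply: infH; exists (size l), (fun i => tnth (in_tuple l) i).
  rewrite -subTset => z _.
  have r0 : residual l z = 0.
    apply: (bop_dense_eq0 dA (bop_residual l)) => x /hd[k _ <-].
    by apply/eqP; apply: contrapT => /negP hk; apply: h; exists k.
  have -> : z = \sum_(x <- l) dot z x *: x by apply/subr0_eq.
  rewrite (big_tnth _ _ l); apply: (subspace_sum (linear_span_subspace _)) => i _.
  apply: (subspaceZ (linear_span_subspace _)); apply: sub_linear_span.
  by exists i.
have /boolp.choice[k hk] := hres.
(* When [d n] already lies in the span of the earlier vectors, a substitute with nonzero residual is
   taken, so every step yields a new unit vector and the basis is indexed by all of [nat]. *)
pose pick l n := if residual l (d n) != 0 then d n else d (k l).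
pose next l n := (nr (residual l (pick l n)))^-1%:C *: residual l (pick l n).
pose G := fix G n := if n is m.+1 then rcons (G m) (next (G m) m) else [::].
pose e n := next (G n) n.
have GE (F : H -> H) n : \sum_(x <- G n) F x = \sum_(0 <= i < n) F (e i).
  elim: n => [|n IH]; first by rewrite big_nil big_geq.
  by rewrite /= -cats1 big_cat big_seq1 IH big_nat_recr.
pose p n := pick (G n) n.
have pn n : residual (G n) (p n) != 0.
  by rewrite /p /pick; case: ifPn => // _; exact: hk.
have pE n : residual (G n) (d n) != 0 -> p n = d n.
  by move=> h; rewrite /p /pick h.
have eE n : e n = (nr (residual (G n) (p n)))^-1%:C *: residual (G n) (p n).
  by [].
clearbody e p; clearbody G; clear pick next hk k hres.
have e1 n : dot (e n) (e n) = 1.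
  rewrite (dotxx dotE) eE nrZ cabs_real ger0_norm ?invr_ge0 ?nr_ge0 //.
  by rewrite mulVf ?expr1n //; exact/lt0r_neq0/nr_gt0/pn.
have eo n : forall i j, (i < n)%N -> (j < n)%N -> dot (e i) (e j) = (i == j)%:R.
  elim: n => [//|n IH].
  have en j : (j < n)%N -> dot (e n) (e j) = 0.
    move=> jn; rewrite eE (dotZl dot) [X in _ * X](_ : _ = 0) ?mulr0 //.
    rewrite /residual GE (dotBl dot).
    rewrite (dot_suml dot) (bigD1_seq j) ?mem_index_iota ?iota_uniq //=.
    rewrite (dotZl dot) e1 mulr1 big_nat_cond big1 ?addr0 ?subrr //.
    move=> i /andP[/andP[_ hi] ij].
    by rewrite (dotZl dot) IH // (negbTE ij) mulr0.
  move=> i j; rewrite !ltnS (leq_eqVlt i) (leq_eqVlt j).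
  move=> /predU1P[->|hi] /predU1P[->|hj].
  - by rewrite e1 eqxx.
  - by rewrite en // gtn_eqF.
  - by rewrite (dotC dot) en // ltn_eqF // conjE conjc0.
  - exact: IH.
exists e; split=> [i j|].
  by apply: (eo (maxn i j).+1); rewrite ltnS ?leq_maxl ?leq_maxr.
have [s1 s2] := linear_span_subspace (range e).
have sp n : linear_span (range e) (\sum_(x <- G n) dot (d n) x *: x).
  rewrite GE; apply: (subspace_sum (linear_span_subspace _)) => i _.
  by apply: (subspaceZ (linear_span_subspace _)); apply: sub_linear_span; exists i.
have sd n : linear_span (range e) (d n).
  have [r0|r0] := eqVneq (residual (G n) (d n)) 0.
    by rewrite (subr0_eq r0).
  have -> : d n = (nr (residual (G n) (d n)))%:C *: e n +
      \sum_(x <- G n) dot (d n) x *: x.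
    rewrite eE pE // scalerA -rmorphM /= divff ?lt0r_neq0 ?nr_gt0 //.
    by rewrite scale1r subrK.
  by apply: s2 => //; apply: sub_linear_span; exists n.
move=> O O0 oO; have [x [Ox /hd[n _ xn]]] := dA O O0 oO.
by exists x; split=> //; rewrite -xn; exact: sd.
Qed.

End GramSchmidt.

(** * Square roots of positive operators *)

Section SquareRoot.
Context {R : realType} {H : completeNormedModType R[i]}.
Variable dot : {dot H for (@Num.conj R[i])}.
Hypothesis dotE : forall x : H, `|x| ^+ 2 = dot x x.
Implicit Types (T : H -> H) (M : R).

Definition selfadjoint T := forall v w, dot (T v) w = dot v (T w).

(** Polarization: [v + w] gives [B v w + B w v = 0], and [v + i w] gives [B v w - B w v = 0]. *)
Lemma form_eq0 (B : H -> H -> R[i]) :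
  (forall u v w, B (u + v) w = B u w + B v w) ->
  (forall u v w, B u (v + w) = B u v + B u w) ->
  (forall c u v, B (c *: u) v = c * B u v) ->
  (forall c u v, B u (c *: v) = c^* * B u v) ->
  (forall v, B v v = 0) -> forall v w, B v w = 0.
Proof.
move=> Dl Dr Zl Zr h v w.
have h1 : B v w + B w v = 0.
  by have := h (v + w); rewrite Dl !Dr !h addr0 add0r.
have h2 : B v w - B w v = 0.
  have := h (v + 'i%C *: w); rewrite Dl !Dr !Zl !Zr !h !mulr0 addr0 add0r.
  have -> : ('i%C : R[i])^* = - 'i%C by apply/eqP; rewrite eq_complex /= oppr0 !eqxx.
  move=> h3; apply: (mulfI (_ : (- 'i%C : R[i]) != 0)).
    by rewrite oppr_eq0 eq_complex /= negb_and oner_neq0 orbT.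
  by rewrite mulr0 -h3; ring.
have : 2 * B v w = 0 by rewrite -[RHS](addr0 0) -{1}h1 -h2; ring.
by move/eqP; rewrite mulf_eq0 pnatr_eq0 /= => /eqP.
Qed.

(** The defect [<T v, w> - <v, T w>] is a sesquilinear form that vanishes on the diagonal because
    [<T v, v>] is real. *)
Lemma positive_selfadjoint T : linear T -> (forall v, 0 <= dot (T v) v) ->
  selfadjoint T.
Proof.
move=> lT pT v w; apply/subr0_eq.
apply: (@form_eq0 (fun v w => dot (T v) w - dot v (T w))) => //=.
- by move=> u1 u2 u3; rewrite (linD lT) !(dotDl dot); ring.
- by move=> u1 u2 u3; rewrite (linD lT) !(dotDr dot); ring.
- by move=> c u1 u2; rewrite (linZ lT) !(dotZl dot); ring.
- by move=> c u1 u2; rewrite (linZ lT) !(dotZr dot); ring.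
move=> u; rewrite [X in _ - X](dotC dot).
by have := pT u; case: (dot _ _) => a b; rewrite lecE /= => /andP[/eqP -> _];
  apply/eqP; rewrite eq_complex /= !subrr oppr0 subrr !eqxx.
Qed.

Lemma positiveP T : selfadjoint T ->
  (forall v, 0 <= complex.Re (dot (T v) v)) -> forall v, 0 <= dot (T v) v.
Proof.
move=> sT h v; move: (h v).
have : dot (T v) v = (dot (T v) v)^*%C by rewrite {1}sT (dotC dot).
case: (dot _ _) => a b /= [bb] a0; rewrite lecE /= a0 andbT.
by apply/eqP; lra.
Qed.

Lemma Re_ge0 (z : R[i]) : 0 <= z -> 0 <= complex.Re z.
Proof. by rewrite lecE => /andP[]. Qed.

Lemma ge0_ReE (z : R[i]) : 0 <= z -> z = (complex.Re z)%:C.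
Proof. by move=> h; rewrite RRe_real // ger0_real. Qed.

(** Positivity at [v - T v] reads [<T v, v> - 2 |T v|^2 + <T (T v), T v> >= 0], and the last term is
    at most [|T v|^2]. *)
Lemma positive_contraction T : bop 1 T -> (forall v, 0 <= dot (T v) v) ->
  forall v, nr (T v) ^+ 2 <= complex.Re (dot (T v) v).
Proof.
move=> hT pT v; have sT := positive_selfadjoint hT.1 pT.
have := Re_ge0 (pT (v - T v)).
rewrite (linB hT.1) (dotBl dot) !(dotBr dot) !ReD !ReN !ReD !ReN.
rewrite (sT (T v) v) -(nr_sqr dotE).
have : complex.Re (dot (T (T v)) (T v)) <= nr (T v) ^+ 2.
  apply: (le_trans (Re_le_cabs _)).
  rewrite (le_trans (cauchy_schwarz dotE _ _)) // expr2 ler_wpM2r ?nr_ge0 //.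
  by have := hT.2 (T v); rewrite mul1r.
by lra.
Qed.

Lemma bop1_compl T : bop 1 T -> (forall v, 0 <= dot (T v) v) ->
  bop 1 (fun v => v - T v).
Proof.
move=> hT pT; split.
  by move=> c x y; rewrite (linD hT.1) (linZ hT.1) scalerBr opprD addrACA.
move=> v; rewrite mul1r -ler_sqr ?nnegrE ?nr_ge0 // (nrB_sqr dotE).
have := positive_contraction hT pT v; have := Re_ge0 (pT v).
by rewrite (dotC_Re dot); lra.
Qed.

Lemma bop_seq_cvg (A : nat -> H -> H) (T : H -> H) M (s : nat -> H) (l : H) :
  (forall n, bop M (A n)) -> (forall z, (A ^~ z) @ \oo --> T z) ->
  s @ \oo --> l -> (fun n => A n (s n)) @ \oo --> T l.
Proof.
move=> hA AT sl.
apply: (@cvg_nr_le _ _ _ _ (fun n => M * nr (s n - l) + nr (A n l - T l))).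
  move=> n; rewrite (_ : A n (s n) - T l = A n (s n - l) + (A n l - T l)).
    by rewrite (le_trans (nrD _ _)) // lerD2r (hA n).2.
  by rewrite (linB (hA n).1) addrA subrK.
rewrite -[X in _ --> X](addr0 0) -[X in X + _](mulr0 M).
apply: cvgD; last exact/cvg_nrP/AT.
by apply: cvgM; [exact: cvg_cst|exact/cvg_nrP].
Qed.

Lemma sqrt_contraction T : bop 1 T -> (forall v, 0 <= dot (T v) v) ->
  exists2 S, bop 2 S & (forall v, 0 <= dot (S v) v) /\ forall v, S (S v) = T v.
Proof.
move=> hT pT; have sT := positive_selfadjoint hT.1 pT.
pose B v := v - T v; have hB : bop 1 B := bop1_compl hT pT.
(* With [B = 1 - T], the iterates [Y] converge to [Y = 1 - sqrt T]; the scalar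
   iterates for [B = 1] dominate all the estimates. *)
pose Y := fix Y n : H -> H :=
  if n is m.+1 then fun z => 2^-1 *: (B z + Y m (Y m z)) else fun=> 0.
pose y := fix y n : R := if n is m.+1 then (1 + y m ^+ 2) / 2 else 0.
have c2 : cabs (2^-1 : R[i]) = 2^-1.
  apply: (mulIf (_ : 2 != 0 :> R)); rewrite ?pnatr_eq0 // mulVf ?pnatr_eq0 //.
  have -> : (2 : R) = cabs (2 : R[i]) by rewrite -(rmorph_nat (real_complex R)) cabs_real normr_nat.
  by rewrite -cabsM mulVf ?pnatr_eq0 // cabs1.
have y01 n : 0 <= y n <= 1.
  elim: n => [|n /andP[h1 h2]] /=; first by rewrite lexx ler01.
  by apply/andP; split; nra.
have ymono n : y n <= y n.+1.
  by case/andP: (y01 n) => h1 h2 /=; nra.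
have hY n : bop (y n) (Y n).
  elim: n => [|n [IHl IHb]] /=; first exact: bop0.
  case/andP: (y01 n) => h1 h2; split.
    move=> c u v; rewrite !(linD IHl) !(linZ IHl) (linD hB.1) (linZ hB.1).
    by rewrite addrACA -(scalerDr c) (scalerDr 2^-1) !scalerA [2^-1 * c]mulrC.
  move=> z; rewrite nrZ c2 [_ / 2]mulrC -mulrA ler_pM2l ?invr_gt0 ?ltr0n //.
  rewrite (le_trans (nrD _ _)) // mulrDl lerD ?hB.2 // expr2 -mulrA.
  by rewrite (le_trans (IHb _)) // ler_wpM2l.
have sY n : selfadjoint (Y n).
  elim: n => [|n IH] v w /=; first by rewrite (dot0l dot) (dot0r dot).
  rewrite (dotZl dot) (dotZr dot) (dotDl dot) (dotDr dot) !IH (dotBl dot).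
  rewrite (dotBr dot) sT; congr (_ * _).
  rewrite -(rmorph_nat (real_complex R)) -fmorphV conjE conjc_real //.
have step n z : nr (Y n.+1 z - Y n z) <= (y n.+1 - y n) * nr z.
  elim: n z => [|n IH] z.
    have -> : Y 0%N z = 0 by [].
    by rewrite subr0 (le_trans ((hY 1%N).2 z)) //= subr0.
  (* The difference of squares is split as [Y' (Y' - Y) + (Y' - Y) Y] with [Y' = Y n.+1], an
     identity that needs no commutation. *)
  have -> : Y n.+2 z - Y n.+1 z =
      2^-1 *: (Y n.+1 (Y n.+1 z - Y n z) + (Y n.+1 (Y n z) - Y n (Y n z))).
    rewrite (linB (hY _).1) addrA subrK.
    rewrite -[Y n.+2 z]/(2^-1 *: (B z + Y n.+1 (Y n.+1 z))).
    rewrite -[in X in _ - X = _]/(2^-1 *: (B z + Y n (Y n z))) -scalerBr.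
    by congr (_ *: _); rewrite opprD addrACA subrr add0r.
  rewrite nrZ c2.
  have -> : y n.+2 - y n.+1 = 2^-1 * (y n.+1 * (y n.+1 - y n) + (y n.+1 - y n) * y n).
    rewrite -[y n.+2]/((1 + y n.+1 ^+ 2) / 2).
    have : y n.+1 = (1 + y n ^+ 2) / 2 by [].
    by generalize (y n.+1) (y n) => a b h; lra.
  rewrite -mulrA ler_pM2l ?invr_gt0 ?ltr0n // (le_trans (nrD _ _)) // mulrDl.
  have [p1 _] := andP (y01 n.+1).
  apply: lerD.
    by rewrite (le_trans ((hY _).2 _)) // -mulrA ler_wpM2l.
  by rewrite (le_trans (IH _)) // -mulrA ler_wpM2l ?subr_ge0 // (hY n).2.
have step' n k z : nr (Y (n + k)%N z - Y n z) <= (y (n + k)%N - y n) * nr z.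
  elim: k => [|k IH]; first by rewrite addn0 !subrr nr0 mul0r.
  rewrite addnS.
  rewrite (_ : Y (n + k).+1 z - Y n z =
    (Y (n + k).+1 z - Y (n + k)%N z) + (Y (n + k)%N z - Y n z)); last first.
    by rewrite addrA subrK.
  rewrite (le_trans (nrD _ _)) // (le_trans (lerD (step _ _) IH)) //.
  by rewrite -mulrDl addrA subrK.
have bY n : bop 1 (Y n) by apply: bop_le (hY n); case/andP: (y01 n).
have [z|Z hZ YZ] := strong_limit bY.
  apply: cauchy_cvgH => e e0.
  have z1 : 0 < nr z + 1 by rewrite ltr_wpDl ?nr_ge0.
  have [|N hN] := nondecreasing_cauchy ymono (K := 1) _ (divr_gt0 e0 z1).
    by move=> n; case/andP: (y01 n).
  exists N.
  have main m n : (N <= n)%N -> (n <= m)%N -> nr (Y m z - Y n z) < e.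
    move=> Nn nm; rewrite -(subnKC nm) (le_lt_trans (step' _ _ _)) // subnKC //.
    have := hN m n (leq_trans Nn nm) Nn; rewrite ltr_pdivlMr //.
    have := nr_ge0 z; have := ler_norm (y m - y n); have := normr_ge0 (y m - y n).
    by nra.
  move=> m n Nm Nn.
  by have [nm|mn] := leqP n m; [|rewrite nrC]; apply: main => //; exact: ltnW.
(* In the limit [2 Z = B + Z^2], that is [(1 - Z)^2 = 1 - B = T]. *)
have ZE z : Z z = 2^-1 *: (B z + Z (Z z)).
  apply: (cvgH_unique (YZ z)); rewrite -cvg_shiftS /=.
  apply: cvgZ; first exact: cvg_cst.
  apply: cvgD; first exact: cvg_cst.
  exact: (bop_seq_cvg bY YZ (YZ z)).
have sZ : selfadjoint Z.
  move=> v w; apply: (cvgC_unique (dot_cvgl dotE w (YZ v))).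
  rewrite (_ : (fun n => _) = fun n => dot v (Y n w)).
    exact: (dot_cvgr dotE v (YZ w)).
  by apply: funext => n; rewrite sY.
exists (fun z => z - Z z); first split.
- by move=> c u v; rewrite (linD hZ.1) (linZ hZ.1) scalerBr opprD addrACA.
- by move=> z; rewrite (le_trans (nrB _ _)) // mulrDl mul1r lerD2l -[X in _ <= X]mul1r hZ.2.
split.
  apply: positiveP.
    by move=> v w; rewrite (dotBl dot) (dotBr dot) sZ.
  move=> v; rewrite (dotBl dot) ReD ReN -(nr_sqr dotE) subr_ge0.
  rewrite (le_trans (Re_le_cabs _)) // (le_trans (cauchy_schwarz dotE _ _)) //.
  by rewrite expr2 ler_wpM2r ?nr_ge0 // -[X in _ <= X]mul1r hZ.2.
move=> v; rewrite (linB hZ.1).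
have : 2 *: Z v = B v + Z (Z v).
  by rewrite [in LHS]ZE scalerA divff ?pnatr_eq0 // scale1r.
rewrite /B scaler_nat mulr2n => h.
rewrite opprB addrACA -opprD h opprD addrACA subrr addr0 opprB addrC.
by rewrite subrK.
Qed.

Lemma sqrt_exists M T : 0 < M -> bop M T -> (forall v, 0 <= dot (T v) v) ->
  exists M' S, [/\ 0 < M', bop M' S, forall v, 0 <= dot (S v) v &
    forall v, S (S v) = T v].
Proof.
move=> M0 hT pT.
have MC : (M%:C : R[i]) != 0 by rewrite eq_complex /= negb_and gt_eqF.
have [||S hS [pS SS]] := @sqrt_contraction (fun z => M^-1%:C *: T z).
- apply: bop_le (bopZ M^-1%:C hT).
  by rewrite cabs_real ger0_norm ?invr_ge0 ?(ltW M0) // mulVf ?gt_eqF.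
- by move=> v; rewrite (dotZl dot) mulr_ge0 // lecR invr_ge0 ltW.
pose r := Num.sqrt M; have r0 : 0 < r by rewrite sqrtr_gt0.
exists (r * 2), (fun z => r%:C *: S z); split; first by rewrite mulr_gt0.
- by apply: bop_le (bopZ r%:C hS); rewrite cabs_real gtr0_norm.
- by move=> v; rewrite (dotZl dot) mulr_ge0 // lecR ltW.
move=> v; rewrite (linZ hS.1) SS !scalerA -!rmorphM /= -expr2 sqr_sqrtr ?ltW //.
by rewrite mulfV ?gt_eqF // scale1r.
Qed.

Variable e : nat -> H.
Hypothesis he : orthonormal_basis dot e.

Lemma is_abs_exists x : bounded_operator x -> exists a, is_abs dot x a.
Proof.
move=> /bounded_operatorP[M M0 hx].
have [xs hxs xsE] := adjoint_exists dotE he (ltW M0) hx.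
have [|||M' [a [M'0 ha pa aa]]] := @sqrt_exists (M * M) (xs \o x).
- by rewrite mulr_gt0.
- by apply: bop_comp => //; exact: ltW.
- move=> v /=; rewrite (dotC dot) -xsE -(dotC dot) (dotxx dotE).
  by rewrite lecR sqr_ge0.
exists a; split; last first.
  by move=> v w; rewrite aa /= (dotC dot) -xsE -(dotC dot).
by split=> //; apply/bounded_operatorP; exists M'.
Qed.

Lemma abs_opP x : bounded_operator x -> is_abs dot x (abs_op dot x).
Proof.
by move=> /is_abs_exists[a ha]; rewrite /abs_op; case: xgetP => // /(_ a).
Qed.

End SquareRoot.

(** * Polar decomposition *)

Section Polar.
Context {R : realType} {H : completeNormedModType R[i]}.
Variable dot : {dot H for (@Num.conj R[i])}.
Hypothesis dotE : forall x : H, `|x| ^+ 2 = dot x x.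
Implicit Types (T : H -> H) (M : R).

Section Iterates.
Variable b : H -> H.
Hypotheses (hb : bop 1 b) (pb : forall v, 0 <= dot (b v) v).

Let sb := positive_selfadjoint hb.1 pb.

Lemma bop_iter k : bop 1 (iter k b).
Proof.
elim: k => [|k IH] /=; first exact: bop_id.
by rewrite -[1]mul1r; exact: bop_comp.
Qed.

Lemma selfadjoint_iter k : selfadjoint dot (iter k b).
Proof. by elim: k => [//|k IH] v w; rewrite iterS sb IH -iterSr. Qed.

Let phi z k := complex.Re (dot (iter k b z) z).

Lemma phiD z j k : phi z (j + k) = complex.Re (dot (iter j b z) (iter k b z)).
Proof. by rewrite /phi addnC iterD selfadjoint_iter. Qed.

Lemma phi_ge0 z k : 0 <= phi z k.
Proof.
rewrite -(odd_double_half k) -addnn; set m := k./2.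
case: (odd k); last by rewrite add0n phiD -(nr_sqr dotE) sqr_ge0.
by rewrite addnA phiD iterS Re_ge0.
Qed.

(** At [k = 2 m] this is [<b u, u> <= |u|^2] with [u = b^m z], and at [k = 2 m + 1] it is
    [|b u|^2 <= <b u, u>]. *)
Lemma phi_mono z k : phi z k.+1 <= phi z k.
Proof.
rewrite -(odd_double_half k) -addnn; set m := k./2.
case: (odd k); last first.
  rewrite add0n -addSn !phiD -(nr_sqr dotE) (le_trans (Re_le_cabs _)) //.
  rewrite (le_trans (cauchy_schwarz dotE _ _)) // expr2 ler_wpM2r ?nr_ge0 //.
  by rewrite -[X in _ <= X]mul1r hb.2.
rewrite (_ : (true + (m + m)).+1 = m.+1 + m.+1)%N; last by rewrite add1n addSn addnS.
by rewrite addnA !phiD -(nr_sqr dotE) /=; exact: positive_contraction.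
Qed.

Lemma phi_le z j k : (j <= k)%N -> phi z k <= phi z j.
Proof.
move=> /subnKC <-; elim: (k - j)%N => [|n IH]; first by rewrite addn0.
by rewrite addnS (le_trans (phi_mono _ _)).
Qed.

Lemma nr_iter_sub z k l :
  nr (iter k b z - iter l b z) ^+ 2 = phi z (k + k) + phi z (l + l) - 2 * phi z (k + l).
Proof. by rewrite (nrB_sqr dotE) !(nr_sqr dotE) !phiD. Qed.

(** The moments [phi z] decrease and are nonnegative, hence form a Cauchy sequence, and
    [nr_iter_sub] writes the squared distances as [(phi (2 k) - phi (k + l)) + (phi (2 l) - phi (k +
    l))]. *)
Lemma iter_cauchy z (e : R) : 0 < e -> exists N, forall k l, (N <= k)%N ->
  (N <= l)%N -> nr (iter k b z - iter l b z) < e.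
Proof.
move=> e0.
have [|||N hN] := @nondecreasing_cauchy R (fun k => - phi z k) 0 _ _ (e ^+ 2 / 2).
- by move=> n; rewrite lerN2 phi_mono.
- by move=> n; rewrite oppr_le0 phi_ge0.
- by rewrite divr_gt0 ?exprn_gt0.
exists N => k l Nk Nl; rewrite -ltr_sqr ?nnegrE ?nr_ge0 ?(ltW e0) //.
rewrite nr_iter_sub.
have h m n : (N <= m)%N -> (N <= n)%N -> phi z m - phi z n < e ^+ 2 / 2.
  move=> Nm Nn; have := hN n m Nn Nm; rewrite opprK.
  by apply: le_lt_trans; rewrite addrC ler_norm.
have Nkl : (N <= k + l)%N by rewrite (leq_trans Nk) // leq_addr.
have := h _ _ (leq_trans Nk (leq_addr k k)) Nkl.
have := h _ _ (leq_trans Nl (leq_addr l l)) Nkl.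
by lra.
Qed.

Lemma iter_step_cvg z :
  (fun k => iter k b z - iter k.+1 b z) @ \oo --> (0 : H).
Proof.
apply/cvg_nrP/cvgrPdist_lt => e e0.
have [N hN] := iter_cauchy z e0; exists N => // k /= Nk.
rewrite sub0r normrN subr0 ger0_norm ?nr_ge0 //.
by have := hN k k.+1 Nk (leqW Nk).
Qed.
End Iterates.

Lemma is_abs_nr x a : is_abs dot x a -> forall v, nr (x v) = nr (a v).
Proof.
move=> [[[la _] pa] aE] v; apply/eqP.
rewrite -(@eqrXn2 _ 2) ?nr_ge0 // !(nr_sqr dotE) -aE.
by rewrite (positive_selfadjoint la pa).
Qed.

(* [w] is the strong limit of [x p_k(a)] with [p_k(a) = sum_(j < k) (1 - a)^j]:
   since [a p_k(a) = 1 - (1 - a)^k] and [x], [a] have the same norms pointwise,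
   everything follows from the convergence of [(1 - a)^k]. *)
Lemma polar_contraction M x a : bop M x -> is_abs dot x a -> bop 1 a ->
  exists2 w, bop 1 w & (forall v, w (a v) = x v) /\
    forall v z, dot (x v) (w z) = dot (a v) z.
Proof.
move=> hx ax ha; have nxa := is_abs_nr ax.
have pa := ax.1.2; have aE := ax.2; have sa := positive_selfadjoint ha.1 pa.
pose b v := v - a v; have hb : bop 1 b := bop1_compl dotE ha pa.
have pb v : 0 <= dot (b v) v.
  rewrite (dotBl dot) subr_ge0 (ge0_ReE (pa v)) (dotxx dotE) lecR.
  rewrite (le_trans (Re_le_cabs _)) // (le_trans (cauchy_schwarz dotE _ _)) //.
  by rewrite expr2 ler_wpM2r ?nr_ge0 // -[X in _ <= X]mul1r ha.2.
have sb := positive_selfadjoint hb.1 pb.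
have aiter k v : a (iter k b v) = iter k b v - iter k.+1 b v.
  by rewrite /= {2}/b opprB addrC subrK.
have comm k v : a (iter k b v) = iter k b (a v).
  elim: k v => [//|k IH] v; rewrite !iterSr IH; congr (iter k b _).
  by rewrite /b (linB ha.1).
pose p k v := \sum_(0 <= j < k) iter j b v.
have ap k v : a (p k v) = v - iter k b v.
  elim: k => [|k IH]; first by rewrite /p big_geq // (lin0 ha.1) subrr.
  by rewrite /p big_nat_recr //= (linD ha.1) -/(p k v) IH aiter addrA subrK.
have pa' k v : p k (a v) = v - iter k b v.
  by rewrite -ap /p (lin_sum ha.1); apply: eq_bigr => i _; rewrite comm.
have lp k : linear (p k).
  move=> c u v; rewrite /p scaler_sumr -big_split /=; apply: eq_bigr => i _.
  by rewrite (bop_iter hb i).1.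
pose W k z := x (p k z).
have hW k : bop 1 (W k).
  split=> [c u v|z]; first by rewrite /W lp hx.1.
  (* [|W k z|^2 = |z - b^k z|^2 = |z|^2 + phi (2 k) - 2 phi k], which is at most [|z|^2] since
     [phi (2 k) <= phi k]. *)
  rewrite /W nxa ap mul1r -ler_sqr ?nnegrE ?nr_ge0 // (nrB_sqr dotE).
  have := phi_mono hb pb z; set phi := fun k => complex.Re (dot (iter k b z) z).
  move=> mono; rewrite (dotC_Re dot) -/(phi k).
  rewrite [nr (iter _ _ _) ^+ 2](nr_sqr dotE) -(phiD hb pb) -/(phi (k + k)%N).
  have := phi_le hb pb z (leq_addr k k); rewrite -/(phi k) -/(phi (k + k)%N).
  have := phi_ge0 hb pb z k; rewrite -/(phi k).
  by lra.
have [z|w hw Ww] := strong_limit hW.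
  apply: cauchy_cvgH => e e0; have [N hN] := iter_cauchy hb pb z e0.
  exists N => m n Nm Nn; rewrite /W -(linB hx.1) nxa (linB ha.1) !ap.
  by rewrite opprB addrC addrA subrK; exact: hN.
have step v := iter_step_cvg hb pb v.
exists w => //; split=> [v|v z].
  apply: (cvgH_unique (Ww (a v))).
  apply: (@cvg_nr_le _ _ _ _ (fun k => nr (iter k b v - iter k.+1 b v - 0))).
    move=> k; rewrite /W pa' -(linB hx.1) addrAC subrr add0r (linN hx.1) nrN nxa.
    by rewrite aiter subr0.
  by apply/cvg_nrP; exact: step.
apply: (cvgC_unique (dot_cvgr dotE (x v) (Ww z))).
rewrite (_ : (fun n => _) =
    fun n => dot (a v) z - dot v (iter n b z - iter n.+1 b z)); last first.
  apply: funext => n; rewrite /W -aE sa ap (dotBr dot) sa.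
  by rewrite [dot v (_ - _)](congr1 (dot v) (esym (aiter n z))) sa.
rewrite -[X in _ --> X]subr0 -[X in _ --> _ - X](dot0r dot v).
apply: cvgB; first exact: cvg_cst.
exact: (dot_cvgr dotE v (step z)).
Qed.

(** Scaling [x] and [a] by the same positive factor does not change [w], so [a] may be taken to be a
    contraction. The second identity is the weak form of [w^* x = a]. *)
Lemma polar x a : bounded_operator x -> is_abs dot x a ->
  exists2 w, bop 1 w & (forall v, w (a v) = x v) /\
    forall v z, dot (x v) (w z) = dot (a v) z.
Proof.
move=> /bounded_operatorP[M M0 hx] ax.
have [N N0 ha] := (bounded_operatorP a).1 ax.1.1.
have t0 : 0 < N^-1 by rewrite invr_gt0.
have tN : (N^-1%:C : R[i]) * N%:C = 1 by rewrite -rmorphM /= mulVf ?gt_eqF.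
have ha1 : bop 1 (fun v => N^-1%:C *: a v).
  apply: bop_le (bopZ N^-1%:C ha).
  by rewrite cabs_real gtr0_norm // mulVf ?gt_eqF.
have [|w hw [wa xw]] := @polar_contraction _ (fun v => N^-1%:C *: x v) _ (bopZ N^-1%:C hx) _ ha1.
- split; first split.
  + by apply/bounded_operatorP; exists 1.
  + by move=> v; rewrite (dotZl dot) mulr_ge0 ?ax.1.2 // lecR ltW.
  move=> v z; rewrite (linZ ha.1) !(dotZl dot) (dotZr dot) ax.2.
  by rewrite conjE conjc_real.
exists w => //; split=> [v|v z].
  have := congr1 (fun u => N%:C *: u) (wa v).
  by rewrite (linZ hw.1) !scalerA mulrC tN !scale1r.
have := congr1 (fun u => N%:C * u) (xw v z).
by rewrite !(dotZl dot) !mulrA [N%:C * _]mulrC tN !mul1r.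
Qed.

End Polar.

(** * The trace norm *)

Lemma sum_cauchy_schwarz (R : realType) (I : Type) (r : seq I) (a b : I -> R) :
  (\sum_(i <- r) a i * b i) ^+ 2 <=
  (\sum_(i <- r) a i ^+ 2) * (\sum_(i <- r) b i ^+ 2).
Proof.
elim: r => [|i r IH]; first by rewrite !big_nil expr0n mulr0.
rewrite !big_cons; move: IH.
set A := \sum_(j <- r) a j * b j; set S := \sum_(j <- r) a j ^+ 2.
set T := \sum_(j <- r) b j ^+ 2 => IH.
have S0 : 0 <= S by apply: sumr_ge0 => j _; exact: sqr_ge0.
have T0 : 0 <= T by apply: sumr_ge0 => j _; exact: sqr_ge0.
(* From [A^2 <= S T] and the inequality of arithmetic and geometric means, compared after
   squaring. *)
have h : 2 * A * (a i * b i) <= S * b i ^+ 2 + T * a i ^+ 2.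
  have p0 : 0 <= S * b i ^+ 2 + T * a i ^+ 2.
    by rewrite addr_ge0 // mulr_ge0 // sqr_ge0.
  rewrite (le_trans (ler_norm _)) // -ler_sqr ?nnegrE ?normr_ge0 //.
  rewrite real_normK ?num_real // !exprMn.
  have := sqr_ge0 (S * b i ^+ 2 - T * a i ^+ 2).
  have := ler_wpM2r (mulr_ge0 (sqr_ge0 (a i)) (sqr_ge0 (b i))) IH.
  by nra.
by nra.
Qed.

Section Trace.
Context {R : realType} {H : completeNormedModType R[i]}.
Variable dot : {dot H for (@Num.conj R[i])}.
Hypothesis dotE : forall x : H, `|x| ^+ 2 = dot x x.
Implicit Types (T : H -> H) (M : R).

(** The very choice made inside [trace], so that [trace] is by definition the series over this
    basis. *)
Definition trace_basis : nat -> H :=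
  xget (fun=> 0) [set e | orthonormal_basis dot e].

Local Notation e := trace_basis.
Hypothesis he : orthonormal_basis dot e.

Let eo : orthonormal_seq dot e := he.1.

Definition diag_sum T m n : R :=
  \sum_(m <= i < n) complex.Re (dot (T (e i)) (e i)).

Section PositiveTrace.
Variables (a : H -> H) (pa : forall v, 0 <= dot (a v) v).

Lemma trace_ge0 : (0 <= trace dot a)%E.
Proof. by apply: nneseries_ge0 => i _ _; rewrite lee_fin Re_ge0. Qed.

Lemma diag_sum_ge0 m n : 0 <= diag_sum a m n.
Proof. by apply: sumr_ge0 => i _; exact: Re_ge0. Qed.

Lemma diag_sum_le n : (trace dot a < +oo)%E -> diag_sum a 0 n <= fine (trace dot a).
Proof.
move=> fa; rewrite -lee_fin fineK ?ge0_fin_numE ?trace_ge0 //.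
rewrite /diag_sum -sumEFin; apply: nneseries_lim_ge => i _.
by rewrite lee_fin Re_ge0.
Qed.

Lemma trace_le (K : R) : (forall n, diag_sum a 0 n <= K) ->
  (trace dot a < +oo)%E /\ fine (trace dot a) <= K.
Proof.
move=> h; have hK : (trace dot a <= K%:E)%E.
  apply: lime_le.
    by apply: is_cvg_nneseries => i _ _; rewrite lee_fin Re_ge0.
  by apply: nearW => n; rewrite sumEFin lee_fin; exact: h.
have fa : (trace dot a < +oo)%E by rewrite (le_lt_trans hK) // ltry.
by split=> //; rewrite -lee_fin fineK // ge0_fin_numE ?trace_ge0.
Qed.

Lemma diag_sum_approx (d : R) : (trace dot a < +oo)%E -> 0 < d ->
  exists n, fine (trace dot a) - d < diag_sum a 0 n.
Proof.
move=> fa d0; apply: contrapT => h.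
have [|_] := @trace_le (fine (trace dot a) - d).
  by move=> n; rewrite leNgt; apply/negP => hn; apply: h; exists n.
by rewrite lerBrDl gerDr leNgt d0.
Qed.

End PositiveTrace.

(** The Hilbert-Schmidt sum of [s D] is computed by rows instead of columns:
    [|<s D e_i, e_j>| = |<D^* s e_j, e_i>|], and Bessel bounds the sum over [i] by [|D^* s e_j|^2].
    Truncation by [bproj k] keeps the exchanged sums finite. *)
Lemma hilbert_schmidt_le (s D : H -> H) M M' (K : R) m n : 0 <= M ->
  bop M' s -> selfadjoint dot s -> bop M D ->
  (forall k, \sum_(0 <= j < k) nr (s (e j)) ^+ 2 <= K) ->
  \sum_(m <= i < n) nr (s (D (e i))) ^+ 2 <= M ^+ 2 * K.
Proof.
move=> M0 hs ss hD hK; have [Ds hDs DsE] := adjoint_exists dotE he M0 hD.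
have key k : \sum_(m <= i < n) nr (bproj dot e k (s (D (e i)))) ^+ 2 <= M ^+ 2 * K.
  rewrite (eq_bigr (fun i =>
    \sum_(0 <= j < k) cabs (dot (s (D (e i))) (e j)) ^+ 2)); last first.
    by move=> i _; rewrite (nr_sum_orthonormal dotE _ _ _ eo).
  rewrite exchange_big /= (le_trans (y := \sum_(0 <= j < k) M ^+ 2 * nr (s (e j)) ^+ 2)) //.
    apply: ler_sum => j _; rewrite -exprMn.
    apply: le_trans (_ : nr (Ds (s (e j))) ^+ 2 <= _); last first.
      by rewrite ler_sqr ?nnegrE ?mulr_ge0 ?nr_ge0 // hDs.2.
    apply: le_trans (bessel dotE (Ds (s (e j))) m n eo).
    apply: ler_sum => i _; rewrite ss DsE (dotC dot) cabs_conj //.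
  by rewrite -mulr_sumr ler_wpM2l // sqr_ge0.
have lim : (fun k => \sum_(m <= i < n) nr (bproj dot e k (s (D (e i)))) ^+ 2) @ \oo
    --> \sum_(m <= i < n) nr (s (D (e i))) ^+ 2.
  apply: cvg_big => [|i _]; first exact: add_continuous.
  have h := nr_cvg (cvg_bproj dotE he (s (D (e i)))).
  by rewrite expr2; exact: (cvgM h h).
by apply: (ler_cvg_to lim (cvg_cst _)); exact: nearW.
Qed.

Local Notation X := (trace_class dot).
Local Notation N := (trace_norm dot).

Lemma trace_norm_ge0 x : X x -> 0 <= N x.
Proof.
move=> [bx _]; have [[_ pa] _] := abs_opP dotE he bx.
exact/fine_ge0/trace_ge0.
Qed.

(* With [x = w a] and [a = s^2], [<x e_i, c e_i> = <s e_i, s w^* c e_i>]; the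
   second factor is square-summable by [hilbert_schmidt_le]. *)
Lemma trace_pairing_sqr x c M m n : X x -> 0 <= M -> bop M c ->
  (\sum_(m <= i < n) cabs (dot (x (e i)) (c (e i)))) ^+ 2 <=
  diag_sum (abs_op dot x) m n * (M ^+ 2 * N x).
Proof.
move=> [bx fx] M0 hc; have ax := abs_opP dotE he bx.
set a := abs_op dot x in ax fx *; have pa := ax.1.2.
have [w hw [wa _]] := polar dotE bx ax.
have [ws hws wsE] := adjoint_exists dotE he ler01 hw.
have [L L0 ha] := (bounded_operatorP a).1 ax.1.1.
have [L' [s [L'0 hs ps ss]]] := sqrt_exists dotE L0 ha pa.
have ssa := positive_selfadjoint hs.1 ps.
have nrs v : nr (s v) ^+ 2 = complex.Re (dot (a v) v).
  by rewrite (nr_sqr dotE) ssa ss (dotC_Re dot).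
have hD : bop M (ws \o c) by rewrite -[M]mul1r; exact: bop_comp.
have le1 : \sum_(m <= i < n) cabs (dot (x (e i)) (c (e i))) <=
    \sum_(m <= i < n) nr (s (e i)) * nr (s ((ws \o c) (e i))).
  apply: ler_sum => i _; rewrite -wa wsE -ss ssa.
  exact: cauchy_schwarz.
apply: le_trans (_ : (\sum_(m <= i < n) nr (s (e i)) * nr (s ((ws \o c) (e i)))) ^+ 2 <= _).
  by rewrite ler_sqr ?nnegrE ?sumr_ge0 // => i _; rewrite ?mulr_ge0 ?nr_ge0 ?cabs_ge0.
apply: le_trans (sum_cauchy_schwarz _ _ _) _; rewrite (eq_bigr _ (fun i _ => nrs (e i))).
rewrite ler_wpM2l //; first exact: diag_sum_ge0.
apply: (hilbert_schmidt_le m n M0 hs ssa hD) => k.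
by rewrite (eq_bigr _ (fun i _ => nrs (e i))); exact: diag_sum_le.
Qed.

Lemma trace_pairing x c M n : X x -> 0 <= M -> bop M c ->
  \sum_(0 <= i < n) cabs (dot (x (e i)) (c (e i))) <= M * N x.
Proof.
move=> Xx M0 hc; have N0 := trace_norm_ge0 Xx.
rewrite -ler_sqr ?nnegrE ?mulr_ge0 ?sumr_ge0 // => [|i _]; last exact: cabs_ge0.
rewrite (le_trans (trace_pairing_sqr 0 n Xx M0 hc)) //.
rewrite exprMn mulrCA ler_wpM2l ?sqr_ge0 // expr2 ler_wpM2r //.
have [bx fx] := Xx; have [[_ pa] _] := abs_opP dotE he bx.
exact: diag_sum_le.
Qed.

(** In [trace_pairing_sqr] the small factor is a tail of the trace of [|x|], which does not depend
    on [c]; this gives one [m] for all contractions. *)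
Lemma trace_pairing_tail x (d : R) : X x -> 0 < d ->
  exists m, forall n c, bop 1 c ->
    \sum_(m <= i < n) cabs (dot (x (e i)) (c (e i))) <= d.
Proof.
move=> Xx d0; have N0 := trace_norm_ge0 Xx; have [bx fx] := Xx.
have [[_ pa] _] := abs_opP dotE he bx.
have N1 : 0 < N x + 1 by rewrite ltr_wpDl.
have [m hm] := diag_sum_approx pa fx (divr_gt0 (exprn_gt0 2 d0) N1).
exists m => n c hc.
have [mn|nm] := leqP m n; last first.
  by rewrite big_geq ?ltW // ltnW.
rewrite -ler_sqr ?nnegrE ?sumr_ge0 ?(ltW d0) // => [|i _]; last exact: cabs_ge0.
rewrite (le_trans (trace_pairing_sqr m n Xx ler01 hc)) // expr1n mul1r.
have : diag_sum (abs_op dot x) m n <= d ^+ 2 / (N x + 1).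
  have := diag_sum_le pa n fx; rewrite /diag_sum (big_cat_nat (leq0n m) mn) /=.
  by move: hm; rewrite /diag_sum /trace_norm; lra.
rewrite ler_pdivlMr // => h.
have := diag_sum_ge0 pa m n; move: N0 h; clear; nra.
Qed.

(** Testing with the polar part [w] is enough: [<x (e i), w (e i)>] is the diagonal entry of
    [|x|]. *)
Lemma trace_norm_le x (K : R) : bounded_operator x ->
  (forall c, bop 1 c -> forall n,
    complex.Re (\sum_(0 <= i < n) dot (x (e i)) (c (e i))) <= K) ->
  X x /\ N x <= K.
Proof.
move=> bx h; have ax := abs_opP dotE he bx; have pa := ax.1.2.
have [w hw [_ xw]] := polar dotE bx ax.
have [|fa leK] := @trace_le _ pa K.
  move=> n; have := h w hw n; rewrite Re_sum /diag_sum.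
  by under eq_bigr do rewrite xw.
by split.
Qed.

(** With the polar part the terms are nonnegative, so one [w] serves every [d] and the bound
    persists for all large [n]. *)
Lemma trace_norm_attained x : X x -> exists2 w, bop 1 w &
  forall d : R, 0 < d -> exists n0, forall n, (n0 <= n)%N ->
    N x - d < complex.Re (\sum_(0 <= i < n) dot (x (e i)) (w (e i))).
Proof.
move=> [bx fx]; have ax := abs_opP dotE he bx; have pa := ax.1.2.
have [w hw [_ xw]] := polar dotE bx ax.
exists w => // d d0; have [m hm] := diag_sum_approx pa fx d0.
exists m => n mn; apply: (lt_le_trans hm).
rewrite Re_sum /diag_sum (big_cat_nat (leq0n m) mn) /=.
under [X in _ <= X + _]eq_bigr do rewrite xw.
by rewrite lerDl; apply: sumr_ge0 => i _; rewrite xw Re_ge0.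
Qed.

End Trace.

(** * The space of trace class operators *)

Section TraceClass.
Context {R : realType} {H : completeNormedModType R[i]}.
Variable dot : {dot H for (@Num.conj R[i])}.
Hypothesis dotE : forall x : H, `|x| ^+ 2 = dot x x.
Implicit Types (T : H -> H) (M : R).

Local Notation e := (trace_basis dot).
Hypothesis he : orthonormal_basis dot e.
Local Notation X := (trace_class dot).
Local Notation N := (trace_norm dot).

Let eo : orthonormal_seq dot e := he.1.

Lemma bop_bounded M T : 0 <= M -> bop M T -> bounded_operator T.
Proof.
move=> M0 hT; apply/bounded_operatorP; exists (M + 1); first by rewrite ltr_wpDl.
by apply: bop_le hT; rewrite lerDl.
Qed.

Lemma bounded_operatorDZ c x y : bounded_operator x -> bounded_operator y ->
  bounded_operator (c *: x + y : H -> H).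
Proof.
move=> /bounded_operatorP[M M0 hx] /bounded_operatorP[K K0 hy].
apply: bop_bounded (bopD (bopZ c hx) hy).
by rewrite addr_ge0 ?mulr_ge0 ?cabs_ge0 // ltW.
Qed.

(** Pairing with a fixed contraction is linear in the operator, so duality gives the triangle
    inequality. *)
Lemma trace_classDZ c x y : X x -> X y ->
  X (c *: x + y) /\ N (c *: x + y) <= cabs c * N x + N y.
Proof.
move=> Xx Xy; apply: (trace_norm_le dotE he).
  by apply: bounded_operatorDZ; [exact: Xx.1|exact: Xy.1].
move=> k hk n.
rewrite (eq_bigr (fun i => c * dot (x (e i)) (k (e i)) + dot (y (e i)) (k (e i)))); last first.
  move=> i _.
  by rewrite -[(c *: x + y) (e i)]/(c *: x (e i) + y (e i)) (dotDl dot) (dotZl dot).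
rewrite big_split -mulr_sumr /= ReD lerD //.
  rewrite (le_trans (Re_le_cabs _)) // cabsM ler_wpM2l ?cabs_ge0 //.
  rewrite (le_trans (cabs_sum _ _ _)) // -[N x]mul1r.
  exact: trace_pairing.
rewrite (le_trans (Re_le_cabs _)) // (le_trans (cabs_sum _ _ _)) // -[N y]mul1r.
exact: trace_pairing.
Qed.

Lemma trace_class0 : X 0 /\ N 0 = 0.
Proof.
have [||X0 N0] := @trace_norm_le _ _ dot dotE he 0 0.
- by apply: bop_bounded bop0.
- move=> c hc n; rewrite big1 // => i _.
  by rewrite -[(0 : H -> H) _]/(0 : H) (dot0l dot).
by split=> //; apply/eqP; rewrite eq_le N0 (trace_norm_ge0 dotE he).
Qed.

Lemma trace_class_subspace : linear_subspace X.
Proof.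
by split; [exact: trace_class0.1|move=> c x y Xx Xy; have [] := trace_classDZ c Xx Xy].
Qed.

Lemma trace_normD x y : X x -> X y -> N (x + y) <= N x + N y.
Proof.
move=> Xx Xy; have [_] := trace_classDZ 1 Xx Xy.
by rewrite scale1r cabs1 mul1r.
Qed.

Lemma trace_normZ_le c x : X x -> N (c *: x) <= cabs c * N x.
Proof.
move=> Xx; have [_] := trace_classDZ c Xx trace_class0.1.
by rewrite addr0 trace_class0.2 addr0.
Qed.

Lemma trace_normN x : X x -> N (- x) = N x.
Proof.
move=> Xx; have h y : X y -> N (- y) <= N y.
  move=> Xy; rewrite -scaleN1r (le_trans (trace_normZ_le _ Xy)) //.
  by rewrite cabsN cabs1 mul1r.
apply/eqP; rewrite eq_le h //= -[x in N x <= _]opprK h //.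
by rewrite -scaleN1r; exact: subspaceZ trace_class_subspace _ _ Xx.
Qed.

Definition rank_one (xi eta : H) : H -> H := fun z => dot z xi *: eta.

Lemma bop_rank_one xi eta : bop (nr xi * nr eta) (rank_one xi eta).
Proof.
split=> [c x y|z].
  by rewrite /rank_one (dotDl dot) (dotZl dot) scalerDl scalerA.
rewrite nrZ mulrAC ler_wpM2r ?nr_ge0 // [_ * nr z]mulrC.
exact: (cauchy_schwarz dotE).
Qed.

Lemma pairing_rank_one x xi eta n : linear x ->
  \sum_(0 <= i < n) dot (x (e i)) (rank_one xi eta (e i)) =
  dot (x (bproj dot e n xi)) eta.
Proof.
move=> lx; rewrite /bproj (lin_sum lx) (dot_suml dot); apply: eq_bigr => i _.
by rewrite (linZ lx) (dotZl dot) (dotZr dot) (dotC dot xi).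
Qed.

(** Pairing [x] with [rank_one xi eta] evaluates the entry [<x xi, eta>]. This makes matrix entries
    continuous for the trace norm. *)
Lemma dot_le_trace_norm x xi eta : X x ->
  cabs (dot (x xi) eta) <= N x * (nr xi * nr eta).
Proof.
move=> Xx; have [M M0 hx] := (bounded_operatorP x).1 Xx.1.
have main u : complex.Re (dot (x u) eta) <= N x * (nr u * nr eta).
  have lim := Re_cvg (dot_cvgl dotE eta (bop_cvg hx (cvg_bproj dotE he u))).
  apply: (ler_cvg_to lim (cvg_cst _)); apply: nearW => n /=.
  rewrite -(pairing_rank_one _ _ _ hx.1) (le_trans (Re_le_cabs _)) //.
  rewrite (le_trans (cabs_sum _ _ _)) // mulrC.
  apply: trace_pairing => //; first by rewrite mulr_ge0 ?nr_ge0.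
  exact: bop_rank_one.
have [c [c1 cE]] := phase (dot (x xi) eta).
by have := main (c *: xi); rewrite (linZ hx.1) (dotZl dot) cE /= nrZ c1 mul1r.
Qed.

Lemma trace_class_rank_one xi eta :
  X (rank_one xi eta) /\ N (rank_one xi eta) <= nr xi * nr eta.
Proof.
apply: (trace_norm_le dotE he).
  by apply: bop_bounded (bop_rank_one xi eta); rewrite mulr_ge0 ?nr_ge0.
move=> c hc n; have [cs hcs csE] := adjoint_exists dotE he ler01 hc.
(* The pairing becomes [<p, xi>] with [p] a partial expansion of [c^* eta], of norm at most
   [|eta|]. *)
rewrite (eq_bigr (fun i => dot (dot (cs eta) (e i) *: e i) xi)); last first.
  move=> i _; rewrite !(dotZl dot) mulrC; congr (_ * _).
  by rewrite (dotC dot) csE -(dotC dot).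
rewrite -(dot_suml dot) (le_trans (Re_le_cabs _)) //.
rewrite (le_trans (cauchy_schwarz dotE _ _)) // mulrC ler_wpM2l ?nr_ge0 //.
by rewrite (le_trans (nr_proj dotE _ _ _ eo)) // -[X in _ <= X]mul1r hcs.2.
Qed.

Lemma finite_rank_bproj x m : bounded_operator x ->
  finite_rank (x \o bproj dot e m).
Proof.
move=> bx; have [M M0 hx] := (bounded_operatorP x).1 bx; split.
  apply: bop_bounded (bop_comp (ltW M0) hx (bop_bproj dotE he m)).
  by rewrite mulr1 ltW.
exists m, (fun i : 'I_m => x (e i)) => _ [z _ <-] /=.
rewrite /bproj (lin_sum hx.1) big_mkord.
apply: (subspace_sum (linear_span_subspace _)) => i _.
rewrite (linZ hx.1); apply: (subspaceZ (linear_span_subspace _)).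
by apply: sub_linear_span; exists i.
Qed.

Lemma bproj_rank_one x m : linear x ->
  x \o bproj dot e m = \sum_(0 <= i < m) rank_one (e i) (x (e i)).
Proof.
move=> lx; apply: funext => z; rewrite /= /bproj (lin_sum lx).
rewrite (big_morph (fun f : H -> H => f z) (id1 := 0) (op1 := +%R)) //.
by apply: eq_bigr => i _; rewrite (linZ lx).
Qed.

(** The truncation error kills [e i] for [i < m] and agrees with [x] on the other basis vectors, so
    its pairings are tails of those of [x]. *)
Lemma trace_norm_bproj x (d : R) : X x -> 0 < d -> exists m,
  N (x - (x \o bproj dot e m)) <= d.
Proof.
move=> Xx d0; have [m hm] := trace_pairing_tail dotE he Xx d0.
have [M M0 hx] := (bounded_operatorP x).1 Xx.1.
exists m; have [||//] := @trace_norm_le _ _ dot dotE he (x - (x \o bproj dot e m)) d.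
  rewrite addrC -scaleN1r; apply: bounded_operatorDZ; last exact: Xx.1.
  exact: (finite_rank_bproj m Xx.1).1.
move=> c hc n.
have E i : dot ((x - (x \o bproj dot e m)) (e i)) (c (e i)) =
    if (i < m)%N then 0 else dot (x (e i)) (c (e i)).
  rewrite -[(x - _) (e i)]/(x (e i) - x (bproj dot e m (e i))).
  have -> : bproj dot e m (e i) = if (i < m)%N then e i else 0.
    rewrite /bproj; case: ltnP => im.
      rewrite (bigD1_seq i) ?mem_index_iota ?iota_uniq //= eo eqxx scale1r.
      by rewrite big1 ?addr0 // => j /negbTE ij; rewrite eo eq_sym ij scale0r.
    rewrite big_nat big1 // => j /= jm; rewrite eo gtn_eqF ?scale0r //.
    exact: leq_trans jm im.
  by case: ltnP => im; rewrite ?subrr ?(dot0l dot) // (lin0 hx.1) subr0.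
rewrite (eq_bigr _ (fun i _ => E i)) (le_trans (Re_le_cabs _)) //.
apply: le_trans _ (hm (maxn m n) c hc); rewrite (le_trans (cabs_sum _ _ _)) //.
have [mn|nm] := leqP m n.
  rewrite (big_cat_nat (leq0n m) mn) /=.
  rewrite big_nat big1 ?add0r => [|i /= im]; last by rewrite im cabs0.
  rewrite big_nat [X in _ <= X]big_nat; apply: ler_sum => i /andP[mi _].
  by rewrite ltnNge mi.
rewrite big_nat big1 => [|i /= im]; last by rewrite (ltn_trans im nm) cabs0.
by apply: sumr_ge0 => i _; exact: cabs_ge0.
Qed.

Lemma trace_class_finite_rank x : finite_rank x -> X x.
Proof.
move=> [bx [n [b hb]]]; elim: n x bx b hb => [|n IH] x bx b hb.
  suff -> : x = 0 by exact: trace_class0.1.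
  apply: funext => z; have [|m [c [a [ha ->]]]] := hb (x z); first by exists z.
  by rewrite big1 // => i _; have [[]] := ha i.
have [M M0 hx] := (bounded_operatorP x).1 bx.
have [xs hxs xsE] := adjoint_exists dotE he (ltW M0) hx.
(* If [b ord0 = 0], the inverse is [0] by convention and [eta = 0]; [eta1] below still holds. *)
pose eta := (nr (b ord0))^-1%:C *: b ord0.
have eta1 : b ord0 = dot (b ord0) eta *: eta.
  have [->|b0] := eqVneq (b ord0) 0; first by rewrite (dot0l dot) scale0r.
  have b1 : (nr (b ord0))%:C != 0 :> R[i].
    by rewrite eq_complex /= negb_and lt0r_neq0 // nr_gt0.
  rewrite (dotZr dot) conjE conjc_real (dotxx dotE) expr2 rmorphM /= mulrA.
  rewrite -rmorphM /= mulVf ?lt0r_neq0 ?nr_gt0 // mul1r scalerA -rmorphM /=.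
  by rewrite mulfV ?lt0r_neq0 ?nr_gt0 // scale1r.
(* [y] is [x] followed by the projection orthogonal to [b ord0]. *)
pose y := x - rank_one (xs eta) eta.
have -> : x = 1 *: y + rank_one (xs eta) eta by rewrite scale1r subrK.
apply: (trace_class_subspace.2); last exact: (trace_class_rank_one _ _).1.
have Ey z : y z = x z - dot (x z) eta *: eta by rewrite xsE.
apply: (IH y _ (fun j => b (lift ord0 j) - dot (b (lift ord0 j)) eta *: eta)).
  rewrite /y addrC -scaleN1r; apply: bounded_operatorDZ => //.
  by apply: bop_bounded (bop_rank_one _ _); rewrite mulr_ge0 ?nr_ge0.
move=> _ [z _ <-]; rewrite Ey.
have [|m [c [a [ha ->]]]] := hb (x z); first by exists z.
rewrite (dot_suml dot) scaler_suml -sumrB.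
apply: (subspace_sum (linear_span_subspace _)) => i _.
rewrite (dotZl dot) -scalerA -scalerBr.
apply: (subspaceZ (linear_span_subspace _)); have [j _ <-] := ha i.
case: (unliftP ord0 j) => [k ->|->]; first by apply: sub_linear_span; exists k.
by rewrite -eta1 subrr; exact: (linear_span_subspace _).1.
Qed.

End TraceClass.

(** * A symmetric face and its Peirce projections *)

Section RealWeights.
Context {R : realType}.

(** The exponent starts at 1 so that the weights sum to 1 and the weighted isometry has trace norm
    1. *)
Definition weight (i : nat) : R := 2^-1 ^+ i.+1.

Lemma weight_gt0 i : 0 < weight i.
Proof. by rewrite exprn_gt0 // invr_gt0. Qed.

Lemma sum_weight n : \sum_(0 <= i < n) weight i = 1 - 2^-1 ^+ n.
Proof.
elim: n => [|n IH]; first by rewrite big_geq // subrr.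
by rewrite big_nat_recr //= IH /weight exprS; field.
Qed.

Lemma weight_le1 i : cabs (weight i)%:C <= 1.
Proof.
rewrite cabs_real gtr0_norm ?weight_gt0 // exprn_ile1 // ?invr_ge0 //.
by rewrite invf_le1 ?ler1n.
Qed.

Lemma cvg_real_complex (r : nat -> R) (l : R) : r @ \oo --> l ->
  (fun n => (r n)%:C : R[i]^o) @ \oo --> (l%:C : R[i]^o).
Proof.
move=> /cvgrPdist_lt h; apply/cvgrPdist_lt => -[a b].
rewrite ltcE /= => /andP[/eqP -> a0]; have := h a a0; apply: filterS => n.
by rewrite -cabsE -rmorphB cabs_real complexr0 ltcR.
Qed.

Lemma cvg_sum_weight :
  (fun n => \sum_(0 <= i < n) (weight i)%:C : R[i]^o) @ \oo --> (1 : R[i]^o).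
Proof.
rewrite (_ : (fun n => _) = fun n => (1 - 2^-1 ^+ n)%:C); last first.
  by apply: funext => n; rewrite -sum_weight rmorph_sum.
apply: cvg_real_complex; rewrite -[X in _ --> X]subr0.
apply: cvgB; first exact: cvg_cst.
apply: cvg_expr; rewrite gtr0_norm ?invr_gt0 // invf_lt1 // ltr1n //.
Qed.

End RealWeights.

Section Face.
Context {R : realType} {H : completeNormedModType R[i]}.
Variable dot : {dot H for (@Num.conj R[i])}.
Hypothesis dotE : forall x : H, `|x| ^+ 2 = dot x x.

Local Notation e := (trace_basis dot).
Hypothesis he : orthonormal_basis dot e.
Local Notation X := (trace_class dot).
Local Notation N := (trace_norm dot).
Let eo : orthonormal_seq dot e := he.1.

Lemma trace_class_bop x : X x -> exists2 M, 0 < M & bop M x.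
Proof. by move=> [/bounded_operatorP]. Qed.

Lemma trace_norm_eq0 x : X x -> N x = 0 -> x = 0.
Proof.
move=> Xx x0; apply: funext => z; apply: (dot_eq dotE) => y.
have := dot_le_trace_norm dotE he z y Xx; rewrite x0 mul0r => h.
rewrite (dot0l dot); apply: cabs_eq0; apply/eqP.
by rewrite eq_le h cabs_ge0.
Qed.

Lemma trace_normZ c x : X x -> N (c *: x) = cabs c * N x.
Proof.
move=> Xx; have [->|c0] := eqVneq c 0.
  by rewrite scale0r cabs0 mul0r (trace_class0 dotE he).2.
have Xcx : X (c *: x) := subspaceZ (trace_class_subspace dotE he) _ Xx.
apply/eqP; rewrite eq_le (trace_normZ_le dotE he) //=.
have := trace_normZ_le dotE he c^-1 Xcx; rewrite scalerA mulVf // scale1r => h.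
have c1 : 0 < cabs c.
  by rewrite lt_def cabs_ge0 andbT; apply: contra c0 => /eqP/cabs_eq0 ->.
have := ler_wpM2l (ltW c1) h.
by rewrite mulrA -cabsM mulfV // cabs1 mul1r.
Qed.

Lemma trace_class_diag (f : nat -> H) D : orthonormal_seq dot f -> bop 1 D ->
  (forall i, D (e i) = (weight i)%:C *: f i) -> X D /\ N D <= 1.
Proof.
move=> fo hD DE; apply: (trace_norm_le dotE he).
  exact: bop_bounded hD.
move=> c hc n; apply: (@le_trans _ _ (\sum_(0 <= i < n) weight i)).
  rewrite Re_sum; apply: ler_sum => i _.
  rewrite DE (dotZl dot) ReM ler_piMr ?(ltW (weight_gt0 _)) //.
  rewrite (le_trans (Re_le_cabs _)) // (le_trans (cauchy_schwarz dotE _ _)) //.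
  rewrite (nr_orthonormal dotE fo) mul1r (le_trans (hc.2 _)) // mul1r.
  by rewrite (nr_orthonormal dotE eo).
by rewrite sum_weight gerBl exprn_ge0 // invr_ge0.
Qed.

(** * The face exposed by an isometry *)

Section Isometry.
Variables v vs : H -> H.
Hypotheses (hv : bop 1 v) (hvs : bop 1 vs).
Hypothesis vE : forall z y, dot (v z) y = dot z (vs y).
Hypothesis vK : forall z, vs (v z) = z.

Definition partial_pairing x n : R[i]^o := \sum_(0 <= i < n) dot (x (e i)) (v (e i)).

(* The partial sums, put on the line of [e 0], converge because [H] is complete. *)
Lemma partial_pairing_cvg x : X x ->
  exists l : R[i], partial_pairing x @ \oo --> (l : R[i]^o).
Proof.
move=> Xx; have [|l hl] := @cauchy_cvgH _ _ (fun n => (partial_pairing x n : R[i]) *: e 0%N).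
  move=> d d0; have [m hm] := trace_pairing_tail dotE he Xx (divr_gt0 d0 (ltr0Sn R 1)).
  exists m => p q mp mq.
  have main a b : (m <= a)%N -> (a <= b)%N ->
      nr ((partial_pairing x b : R[i]) *: e 0%N - (partial_pairing x a : R[i]) *: e 0%N) < d.
    move=> ma ab; rewrite -scalerBl nrZ (nr_orthonormal dotE eo) mulr1.
    rewrite /partial_pairing (big_cat_nat (leq0n a) ab) /= addrAC subrr add0r.
    rewrite (le_lt_trans (cabs_sum _ _ _)) //.
    apply: (@le_lt_trans _ _ (d / 2)); last by rewrite ltr_pdivrMr // ltr_pMr // ltr1n.
    apply: le_trans (hm b v hv); rewrite (big_cat_nat ma ab) /= lerDr.
    by apply: sumr_ge0 => i _; exact: cabs_ge0.
  by have [pq|qp] := leqP p q; [rewrite nrC|]; apply: main => //; exact: ltnW.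
exists (dot l (e 0%N)); have := dot_cvgl dotE (e 0%N) hl.
rewrite (_ : (fun n => _) = partial_pairing x) //; apply: funext => n.
by rewrite (dotZl dot) eo eqxx mulr1.
Qed.

(** The functional [Tr (v^* x)]. On the trace class the partial sums converge, so the default [0] is
    not what is returned for want of a limit. *)
Definition pairing x : R[i] :=
  xget 0 [set l : R[i] | partial_pairing x @ \oo --> (l : R[i]^o)].

Lemma cvg_pairing x : X x -> partial_pairing x @ \oo --> (pairing x : R[i]^o).
Proof.
move=> /partial_pairing_cvg[l hl].
exact: (@xgetPex _ 0 [set l : R[i] | partial_pairing x @ \oo --> (l : R[i]^o)]
  (ex_intro _ l hl)).
Qed.

Lemma pairing_eq x (l : R[i]) : X x -> partial_pairing x @ \oo --> (l : R[i]^o) ->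
  pairing x = l.
Proof. by move=> Xx hl; exact: (cvgC_unique (cvg_pairing Xx) hl). Qed.

Lemma pairing_linear : linear_on X (pairing : (H -> H) -> R[i]^o).
Proof.
move=> c x y Xx Xy; apply: pairing_eq.
  exact: (trace_class_subspace dotE he).2.
rewrite (_ : partial_pairing _ =
    fun n => (c : R[i]^o) *: partial_pairing x n + partial_pairing y n).
  apply: cvgD; last exact: cvg_pairing.
  by apply: cvgZ; [exact: cvg_cst|exact: cvg_pairing].
apply: funext => n; rewrite /partial_pairing scaler_sumr -big_split /=.
apply: eq_bigr => i _.
by rewrite -[(c *: x + y) _]/(c *: x (e i) + y (e i)) (dotDl dot) (dotZl dot).
Qed.

Lemma pairing_le x : X x -> cabs (pairing x) <= N x.
Proof.
move=> Xx; have [c [c1 cE]] := phase (pairing x).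
have lim : (fun n => c * partial_pairing x n : R[i]^o) @ \oo -->
    (c * pairing x : R[i]^o).
  exact: (cvgZ (@cvg_cst R[i]^o c nat \oo _) (cvg_pairing Xx)).
have := Re_cvg lim; rewrite cE /= => lim'.
apply: (ler_cvg_to lim' (cvg_cst _)); apply: nearW => n /=.
rewrite (le_trans (Re_le_cabs _)) // cabsM c1 mul1r (le_trans (cabs_sum _ _ _)) //.
by rewrite -[X in _ <= X]mul1r; exact: trace_pairing.
Qed.

Lemma isometry_dot z y : dot (v z) (v y) = dot z y.
Proof. by rewrite vE vK. Qed.

Lemma isometry_nr z : nr (v z) = nr z.
Proof. by apply/eqP; rewrite -(@eqrXn2 _ 2) ?nr_ge0 // !(nr_sqr dotE) isometry_dot. Qed.

Lemma isometry_orthonormal : orthonormal_seq dot (v \o e).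
Proof. by move=> i j; rewrite /= isometry_dot eo. Qed.

(** This [g] shows that the face is nonempty and that the functional has norm 1. Its weights are all
    positive, which makes it a sharp test operator for the orthogonal complement. *)
Lemma weighted_exists : exists g, [/\ bop 1 g, X g, N g = 1,
  pairing g = 1 & forall i, g (e i) = (weight i)%:C *: v (e i)].
Proof.
have [g hg gE] := diag_exists dotE he isometry_orthonormal (@weight_le1 R).
have [Xg Ng] := trace_class_diag isometry_orthonormal hg gE.
have g1 : pairing g = 1.
  apply: pairing_eq => //; rewrite (_ : partial_pairing g =
      fun n => \sum_(0 <= i < n) (weight i)%:C); first exact: cvg_sum_weight.
  apply: funext => n; apply: eq_bigr => i _.
  by rewrite gE (dotZl dot) isometry_orthonormal eqxx mulr1.
exists g; split=> //; apply/eqP; rewrite eq_le Ng -(@cabs1 R) -g1.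
exact: pairing_le.
Qed.

Definition face : set (H -> H) := [set f | unit_ball X N f /\ pairing f = 1].

Lemma norm_exposed_face_face : norm_exposed_face X N face.
Proof.
have [g [hg Xg Ng g1 _]] := weighted_exists.
split; first by exists g; split=> //; split=> //; rewrite Ng.
exists pairing; split=> //; first exact: pairing_linear.
apply/eqP; rewrite eq_le; apply/andP; split.
  apply: ge_ereal_sup => _ [x [Xx Nx] <-].
  by rewrite lee_fin (le_trans (pairing_le Xx)).
apply: ereal_sup_ubound; exists g; first by split=> //; rewrite Ng.
by rewrite g1 -/(cabs 1) cabs1.
Qed.

(** * The closed span of the face *)

Local Notation P := (v \o vs).

Lemma bop_P : bop 1 P.
Proof. by rewrite -[1]mul1r; exact: bop_comp. Qed.

Lemma P_selfadjoint : selfadjoint dot P.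
Proof. by move=> z y /=; rewrite vE (dotC dot) -vE -(dotC dot). Qed.

Lemma PK z : P (P z) = P z.
Proof. by rewrite /= vK. Qed.

(** The condition is on the range only, because the initial space of [v] is all of [H]. *)
Definition corner : set (H -> H) := [set x | X x /\ P \o x = x].

Lemma cornerP x z : corner x -> P (x z) = x z.
Proof. by move=> [_ h]; rewrite -[RHS](congr1 (fun f => f z) h). Qed.

Lemma corner_subspace : linear_subspace corner.
Proof.
split.
  split; first exact: (trace_class0 dotE he).1.
  by apply: funext => z; exact: (lin0 bop_P.1).
move=> c x y cx cy; split; first exact: (trace_class_subspace dotE he).2 cx.1 cy.1.
apply: funext => z; rewrite -[LHS]/(P (c *: x z + y z)).
by rewrite (linD bop_P.1) (linZ bop_P.1) !cornerP.
Qed.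

(* Perturbing the contraction [v] by [t *: rank_one xi eta], whose range is
   orthogonal to that of [v], increases its norm only to second order in [t],
   so the first-order term [dot (x xi) eta] must vanish. *)
Lemma face_dot_eq0 x xi eta : face x -> vs eta = 0 -> dot (x xi) eta = 0.
Proof.
move=> [[Xx Nx] x1] eta0; have [M M0 hx] := trace_class_bop Xx.
(* The condition [vs y = 0] is stable under scalars, so a phase turns this one-sided bound into the
   vanishing of the entry. *)
suff main y : vs y = 0 -> complex.Re (dot (x xi) y) <= 0.
  have [c [c1 cE]] := phase (dot (x xi) eta).
  have := main (c^* *: eta); rewrite (linZ hvs.1) eta0 scaler0 => /(_ erefl).
  rewrite (dotZr dot) conjCK cE /= => h.
  by apply/cabs_eq0/eqP; rewrite eq_le h cabs_ge0.
move=> y0; set K := nr xi * nr y; have K0 : 0 <= K by rewrite mulr_ge0 ?nr_ge0.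
rewrite leNgt; apply/negP => d0; set d := complex.Re _ in d0.
have step (t : R) : 0 < t -> t * d <= t ^+ 2 * K ^+ 2.
  move=> t0.
  (* By orthogonality of the ranges the squared norm is at most [1 + t^2 K^2], which is at most its
     own square. *)
  have hc : bop (1 + t ^+ 2 * K ^+ 2) (v + t%:C *: rank_one dot xi y).
    have [lc _] := bopD hv (bopZ t%:C (bop_rank_one dotE xi y)).
    split=> // z; rewrite -ler_sqr ?nnegrE ?mulr_ge0 ?nr_ge0 ?addr_ge0 ?sqr_ge0 //; last first.
      by rewrite mulr_ge0 ?sqr_ge0.
    rewrite -[(v + _) z]/(v z + t%:C *: rank_one dot xi y z) (nrD_sqr dotE).
    rewrite (dotZr dot) /rank_one (dotZr dot) vE y0 (dot0r dot) !mulr0.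
    rewrite addr0.
    rewrite isometry_nr nrZ cabs_real gtr0_norm //.
    have h := (bop_rank_one dotE xi y).2 z; rewrite /rank_one -/K in h.
    have : nr (dot z xi *: y) ^+ 2 <= (K * nr z) ^+ 2.
      by rewrite ler_sqr ?nnegrE ?mulr_ge0 ?nr_ge0.
    rewrite [(t * _) ^+ 2]exprMn [(K * _) ^+ 2]exprMn [((1 + _) * _) ^+ 2]exprMn.
    have := sqr_ge0 t; have := sqr_ge0 (nr z); have := sqr_ge0 K.
    set A := nr (dot z xi *: y) ^+ 2; set B := nr z ^+ 2; set KK := K ^+ 2.
    set T := t ^+ 2 => KK0 B0 T0 hA.
    have h1 : T * A <= T * (KK * B) by rewrite ler_wpM2l.
    have h2 := mulr_ge0 T0 (mulr_ge0 KK0 B0).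
    have h3 := mulr_ge0 (mulr_ge0 T0 KK0) (mulr_ge0 (mulr_ge0 T0 KK0) B0).
    by move: h1 h2 h3; clearbody A B KK T; nra.
  have lim : (fun n => partial_pairing x n + t%:C * dot (x (bproj dot e n xi)) y : R[i]^o)
      @ \oo --> (1 + t%:C * dot (x xi) y : R[i]^o).
    rewrite -x1; apply: cvgD; first exact: cvg_pairing.
    apply: (cvgZ (@cvg_cst R[i]^o t%:C nat \oo _)).
    exact: (dot_cvgl dotE y (bop_cvg hx (cvg_bproj dotE he xi))).
  have := Re_cvg lim; rewrite ReD ReM /= -/d => lim'.
  suff : 1 + t * d <= 1 + t ^+ 2 * K ^+ 2 by lra.
  apply: (ler_cvg_to lim' (cvg_cst _)); apply: nearW => n.
  rewrite -(pairing_rank_one _ _ _ _ hx.1) mulr_sumr -big_split /=.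
  rewrite (eq_bigr (fun i => dot (x (e i)) ((v + t%:C *: rank_one dot xi y) (e i)))); last first.
    move=> i _; rewrite -[(v + _) _]/(v (e i) + t%:C *: rank_one dot xi y (e i)).
    by rewrite (dotDr dot) (dotZr dot) conjE conjc_real.
  rewrite (le_trans (Re_le_cabs _)) // (le_trans (cabs_sum _ _ _)) //.
  have c0 : 0 <= 1 + t ^+ 2 * K ^+ 2 by rewrite addr_ge0 // mulr_ge0 ?sqr_ge0.
  rewrite (le_trans (trace_pairing dotE he n Xx c0 hc)) //.
  by rewrite ler_piMr.
have K1 : 0 < K ^+ 2 + 1 by rewrite ltr_wpDl ?sqr_ge0.
(* Small enough that [t K^2 < d], against [step]. *)
pose t := d / (K ^+ 2 + 1); have t0 : 0 < t by rewrite divr_gt0.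
have dE : d = t * (K ^+ 2 + 1) by rewrite divfK // lt0r_neq0.
have := step t t0; have := mulr_gt0 t0 t0; rewrite [in X in _ -> X -> _]dE.
by clearbody t; move: (K ^+ 2) => k; nra.
Qed.

Lemma face_sub_corner : face `<=` corner.
Proof.
move=> x Fx; split; first exact: Fx.1.1.
apply: funext => z; apply: (dot_eq dotE) => y /=; apply/subr0_eq.
rewrite (_ : _ - _ = - dot (x z) (y - P y)).
  by rewrite face_dot_eq0 ?oppr0 // (linB hvs.1) /= vK subrr.
by rewrite (dotBr dot) -P_selfadjoint opprB.
Qed.

(** [corner] is a subspace cut out by conditions on matrix entries, which are continuous for the
    trace norm. *)
Lemma closed_span_sub_corner : closed_span X N face `<=` corner.
Proof.
move=> x [Xx hx]; split=> //; apply: funext => z; apply: (dot_eq dotE) => y /=.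
apply/subr0_eq; apply: cabs_eq0; apply/eqP; rewrite eq_le cabs_ge0 andbT.
set K := nr z * nr (y - P y); have K0 : 0 <= K by rewrite mulr_ge0 ?nr_ge0.
have K1 : 0 < K + 1 by rewrite ltr_wpDl.
apply/ler_addgt0Pr => d d0; rewrite add0r.
have [s /(linear_span_sub corner_subspace face_sub_corner) cs hs] := hx _ (divr_gt0 d0 K1).
have Xxs : X (x - s) := subspaceB (trace_class_subspace dotE he) Xx cs.1.
have -> : dot (v (vs (x z))) y - dot (x z) y = - dot ((x - s) z) (y - P y).
  rewrite -[(x - s) z]/(x z - s z) (dotBr dot) -P_selfadjoint.
  by rewrite (linB bop_P.1) (cornerP _ cs) opprB !(dotBl dot) /=; ring.
rewrite cabsN (le_trans (dot_le_trace_norm dotE he _ _ Xxs)) // -/K.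
have N0 := trace_norm_ge0 dotE he Xxs.
by move: hs; rewrite ltr_pdivlMr //; nra.
Qed.

Lemma face_rank_one z : nr z = 1 -> face (rank_one dot z (v z)).
Proof.
move=> z1; have [Xr Nr] := trace_class_rank_one dotE he z (v z).
split; first by split=> //; rewrite (le_trans Nr) // isometry_nr z1 mulr1.
apply: pairing_eq => //; rewrite (_ : partial_pairing _ =
    fun n => dot (bproj dot e n z) z).
  have := dot_cvgl dotE z (cvg_bproj dotE he z).
  by rewrite (dotxx dotE) z1 expr1n.
apply: funext => n; rewrite /bproj (dot_suml dot); apply: eq_bigr => i _.
by rewrite !(dotZl dot) isometry_dot mulrC.
Qed.

Lemma span_face_diag z : linear_span face (rank_one dot z (v z)).
Proof.
have ss := linear_span_subspace face.
have [->|z0] := eqVneq z 0.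
  rewrite (_ : rank_one _ _ _ = 0); first exact: ss.1.
  by apply: funext => y; rewrite /rank_one (lin0 hv.1) scaler0.
have p := nr_gt0 z0; pose z' := (nr z)^-1%:C *: z.
have z'1 : nr z' = 1.
  by rewrite nrZ cabs_real gtr0_norm ?invr_gt0 // mulVf // lt0r_neq0.
rewrite (_ : rank_one _ _ _ = (nr z ^+ 2)%:C *: rank_one dot z' (v z')).
  by apply: subspaceZ => //; apply: sub_linear_span; exact: face_rank_one.
apply: funext => y.
rewrite -[RHS]/((nr z ^+ 2)%:C *: (dot y z' *: v z')) /z' (linZ hv.1) (dotZr dot).
rewrite conjE conjc_real !scalerA /rank_one; congr (_ *: _).
rewrite !fmorphV rmorphXn /=; field.
by rewrite eq_complex /= negb_and lt0r_neq0.
Qed.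

(** Polarization of [z |-> rank_one z (v z)], whose values lie in the span: the vectors [xi + eta]
    and [xi + i eta] isolate the cross term, since [rank_one] is conjugate-linear in its first
    argument. *)
Lemma span_face_rank_one xi eta : linear_span face (rank_one dot xi (v eta)).
Proof.
have ss := linear_span_subspace face.
pose q z := rank_one dot z (v z).
have Sq z : linear_span face (q z) := span_face_diag z.
have i2 : ('i%C : R[i]) * 'i%C = -1 by rewrite -expr2 sqr_i.
have ci : ('i%C : R[i])^* = - 'i%C by apply/eqP; rewrite eq_complex /= oppr0 !eqxx.
have -> : rank_one dot xi (v eta) = 2^-1 *: ((q (xi + eta) - q xi - q eta)
    + (- 'i%C) *: (q (xi + 'i%C *: eta) - q xi - q eta)).
  apply: funext => z; apply: (dot_eq dotE) => w.
  rewrite -[X in _ = dot X _]/(2^-1 *: ((q (xi + eta) z - q xi z - q eta z)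
    + (- 'i%C) *: (q (xi + 'i%C *: eta) z - q xi z - q eta z))).
  rewrite /q /rank_one !(linD hv.1) (linZ hv.1) !(dotDr dot) !(dotZr dot) ci.
  rewrite !(dotZl dot, dotDl dot, dotNl dot).
  apply: (mulfI (_ : (2 : R[i]) != 0)); first by rewrite pnatr_eq0.
  rewrite [RHS]mulrA mulfV ?pnatr_eq0 // mul1r.
  ring: i2.
apply: subspaceZ => //; apply: subspaceD => //.
  by do 2! (apply: subspaceB => //).
by apply: subspaceZ => //; do 2! (apply: subspaceB => //).
Qed.

(** The truncation of [x] is the sum of the [rank_one (e i) (x (e i))], and
    [x (e i) = v (vs (x (e i)))] lies in the range of [v]. *)
Lemma corner_sub_closed_span : corner `<=` closed_span X N face.
Proof.
move=> x cx; have [M M0 hx] := trace_class_bop cx.1; split; first exact: cx.1.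
move=> d d0; have [m hm] := trace_norm_bproj dotE he cx.1 (divr_gt0 d0 (ltr0Sn R 1)).
exists (x \o bproj dot e m); last first.
  by rewrite (le_lt_trans hm) // ltr_pdivrMr // ltr_pMr // ltr1n.
rewrite (bproj_rank_one _ _ hx.1); apply: subspace_sum.
  exact: linear_span_subspace.
by move=> i _; rewrite -(cornerP _ cx); exact: span_face_rank_one.
Qed.

Lemma closed_span_face : closed_span X N face = corner.
Proof.
by apply/seteqP; split; [exact: closed_span_sub_corner|exact: corner_sub_closed_span].
Qed.

(* A contraction [w] attaining [N (f + s g) = N f + N g] must agree with [s v]
   because all the weights of [g] are positive; hence [N f <= s * Re (u f)]. *)
Lemma norm_attained_sign (s : R) f g : X f -> X g ->
  `|s| = 1 -> (forall i, g (e i) = (weight i)%:C *: v (e i)) ->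
  N (f + s%:C *: g) = N f + 1 -> N f <= s * complex.Re (pairing f).
Proof.
move=> Xf Xg s1 gE Nfg; have ss := trace_class_subspace dotE he.
have Xfg : X (f + s%:C *: g) by apply: subspaceD => //; exact: subspaceZ.
have [w hw attained] := trace_norm_attained dotE he Xfg.
pose r i := s * complex.Re (dot (v (e i)) (w (e i))).
have s2 : s * s = 1 by rewrite -expr2 -real_normK ?num_real // s1 expr1n.
have r1 i : r i <= 1.
  rewrite (le_trans (ler_norm _)) // normrM s1 mul1r.
  rewrite -lecR (le_trans (normc_ge_Re _)) // -cabsE lecR.
  rewrite (le_trans (cauchy_schwarz dotE _ _)) // isometry_nr.
  rewrite (nr_orthonormal dotE eo) mul1r (le_trans (hw.2 _)) // mul1r.
  by rewrite (nr_orthonormal dotE eo).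
pose A n := complex.Re (\sum_(0 <= i < n) dot (f (e i)) (w (e i))).
have E n : complex.Re (\sum_(0 <= i < n) dot ((f + s%:C *: g) (e i)) (w (e i))) =
    A n + \sum_(0 <= i < n) weight i * r i.
  rewrite /A !Re_sum -big_split /=; apply: eq_bigr => i _.
  rewrite -[(f + _) _]/(f (e i) + s%:C *: g (e i)) (dotDl dot) ReD gE.
  by rewrite !(dotZl dot) !ReM mulrCA.
have A_le n : A n <= N f.
  rewrite /A (le_trans (Re_le_cabs _)) // (le_trans (cabs_sum _ _ _)) //.
  by rewrite -[N f]mul1r; exact: trace_pairing.
have w1 n : \sum_(0 <= i < n) weight i <= 1 :> R.
  by rewrite sum_weight gerBl exprn_ge0 // invr_ge0.
have wr n : \sum_(0 <= i < n) weight i * r i <= 1.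
  apply: le_trans (w1 n); apply: ler_sum => i _.
  by rewrite ler_piMr // ltW // weight_gt0.
have r_eq1 j : r j = 1.
  (* If [r j < 1], the pairing stays below [N f + 1] by the fixed amount [weight j * (1 - r j)],
     while [attained] makes the defect arbitrarily small. *)
  apply/eqP; rewrite eq_le r1 /= leNgt; apply/negP => rj.
  have d0 : 0 < weight j * (1 - r j) by rewrite mulr_gt0 ?weight_gt0 // subr_gt0.
  have [n0 hn0] := attained _ d0.
  have := hn0 (maxn n0 j.+1) (leq_maxl _ _); rewrite E Nfg.
  set n := maxn _ _; apply/negP; rewrite -leNgt.
  have jn : (j < n)%N by rewrite leq_maxr.
  have : weight j * (1 - r j) <= \sum_(0 <= i < n) weight i * (1 - r i).
    rewrite (bigD1_seq j) ?mem_index_iota ?iota_uniq //= lerDl.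
    by apply: sumr_ge0 => i _; rewrite mulr_ge0 ?subr_ge0 // ltW // weight_gt0.
  rewrite (eq_bigr (fun i => weight i - weight i * r i)); last first.
    by move=> i _; rewrite mulrBr mulr1.
  by rewrite sumrB; have := A_le n; have := w1 n; lra.
(* Equality case of Cauchy-Schwarz: [|w (e j)| <= 1] and its real inner product with the unit vector
   [s v (e j)] is 1. *)
have wE j : w (e j) = s%:C *: v (e j).
  apply/subr0_eq/nr_eq0/eqP; rewrite -sqrf_eq0 eq_le sqr_ge0 andbT.
  rewrite (nrB_sqr dotE) nrZ cabs_real s1 mul1r isometry_nr (nr_orthonormal dotE eo).
  rewrite (dotC_Re dot) (dotZl dot) ReM -/(r j) r_eq1.
  have := hw.2 (e j); rewrite mul1r (nr_orthonormal dotE eo).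
  by have := nr_ge0 (w (e j)); nra.
have AE n : A n = s * complex.Re (partial_pairing f n).
  rewrite /A /partial_pairing !Re_sum mulr_sumr; apply: eq_bigr => i _.
  by rewrite wE (dotZr dot) conjE conjc_real ReM.
apply/ler_addgt0Pr => d d0; rewrite -lerBlDr.
have lim : (fun n => s * complex.Re (partial_pairing f n)) @ \oo -->
    s * complex.Re (pairing f).
  by apply: cvgM; [exact: cvg_cst|exact: Re_cvg (cvg_pairing Xf)].
apply: (ler_cvg_to (cvg_cst _) lim); have [n0 hn0] := attained _ d0.
exists n0 => // n /= /hn0; rewrite E Nfg -AE.
by have := wr n; lra.
Qed.

(** Orthogonality to the weighted operator [g] gives norm equality for both signs, hence
    [N f <= Re (u f)] and [N f <= - Re (u f)]. *)
Lemma diamond_compl_face : diamond_compl X N face = [set 0].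
Proof.
have [X0 N0] := trace_class0 dotE he.
apply/seteqP; split=> [f [Xf hf]|_ ->]; last first.
  split=> // g [[Xg _] _]; split; first by rewrite add0r sub0r trace_normN.
  by rewrite add0r N0 add0r.
have [g [hg Xg Ng g1 gE]] := weighted_exists.
have [|h1 h2] := hf g; first by split=> //; split=> //; rewrite Ng.
rewrite Ng in h2; apply: trace_norm_eq0 => //.
have hp : N f <= 1 * complex.Re (pairing f).
  by apply: (norm_attained_sign Xf Xg _ gE); rewrite ?normr1 // scale1r.
have hm : N f <= -1 * complex.Re (pairing f).
  apply: (norm_attained_sign Xf Xg _ gE); first by rewrite normrN1.
  by rewrite rmorphN1 scaleN1r -h1.
apply/eqP; rewrite eq_le trace_norm_ge0 // andbT; lra.
Qed.

(** * The reflection and the uniqueness of the first Peirce projection *)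

Definition reflection (x : H -> H) : H -> H := fun z => 2 *: P (x z) - x z.

Lemma P_reflection x z : P (reflection x z) = P (x z).
Proof.
rewrite /reflection (linB bop_P.1) (linZ bop_P.1) PK.
by rewrite scaler_nat mulr2n addrK.
Qed.

Lemma reflectionK x : reflection (reflection x) = x.
Proof.
apply: funext => z; rewrite -[LHS]/(2 *: P (reflection x z) - reflection x z).
by rewrite P_reflection /reflection opprB addrC subrK.
Qed.

Lemma reflectionDZ c x y : reflection (c *: x + y) = c *: reflection x + reflection y.
Proof.
apply: funext => z.
rewrite -[LHS]/(2 *: P (c *: x z + y z) - (c *: x z + y z)).
rewrite -[RHS]/(c *: (2 *: P (x z) - x z) + (2 *: P (y z) - y z)).
rewrite (linD bop_P.1) (linZ bop_P.1) scalerDr opprD addrACA scalerBr.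
by rewrite !scalerA [2 * c]mulrC.
Qed.

Lemma reflection_dot x z y :
  dot (reflection x z) (reflection x y) = dot (x z) (x y).
Proof.
rewrite /reflection !(dotBl dot) !(dotBr dot) !(dotZl dot) !(dotZr dot).
rewrite !P_selfadjoint PK rmorph_nat; ring.
Qed.

Lemma reflection_trace_class x : X x -> X (reflection x) /\ N (reflection x) = N x.
Proof.
move=> [bx fx]; have absE : abs_op dot (reflection x) = abs_op dot x.
  rewrite /abs_op; congr (xget 0 _); apply/seteqP; split=> a [pa ha]; split=> // z y.
    by rewrite ha reflection_dot.
  by rewrite ha reflection_dot.
split; last by rewrite /trace_norm absE.
split; last by rewrite absE.
have [M M0 hx] := (bounded_operatorP x).1 bx.
rewrite (_ : reflection x = 2 *: (P \o x) + (-1) *: x :> (H -> H)); last first.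
  by apply: funext => z; rewrite scaleN1r.
apply: bop_bounded (bopD (bopZ 2 (bop_comp ler01 bop_P hx)) (bopZ (-1) hx)).
by rewrite addr_ge0 // mulr_ge0 ?cabs_ge0 // ?mul1r ltW.
Qed.

Lemma reflection_fixed x : X x /\ reflection x = x <-> corner x.
Proof.
split=> [[Xx h]|cx].
  split=> //; apply: funext => z; have := congr1 (fun f => f z) h.
  rewrite /reflection => h'; have : 2 *: P (x z) = 2 *: x z.
    by rewrite -[LHS](subrK (x z)) h' scaler_nat mulr2n.
  by move/(congr1 (fun y => 2^-1 *: y)); rewrite !scalerA mulVf ?pnatr_eq0 // !scale1r.
split; first exact: cx.1.
apply: funext => z; rewrite /reflection cornerP // scaler_nat mulr2n addrK //.
Qed.

Lemma trace_class_corner x : X x -> X (P \o x).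
Proof.
move=> Xx; have ss := trace_class_subspace dotE he.
rewrite (_ : P \o x = 2^-1 *: (reflection x + x)).
  by apply: subspaceZ => //; apply: subspaceD => //; case: (reflection_trace_class Xx).
apply: funext => z.
rewrite -[RHS]/(2^-1 *: (2 *: P (x z) - x z + x z)) subrK scalerA.
by rewrite mulVf ?pnatr_eq0 // scale1r.
Qed.

Lemma corner_comp x : X x -> corner (P \o x).
Proof. by move=> Xx; split; [exact: trace_class_corner|apply: funext => z; exact: PK]. Qed.

Lemma reflection_symmetry : is_symmetry X N face reflection.
Proof.
split.
- by move=> c x y _ _; exact: reflectionDZ.
- split; first by move=> x /reflection_trace_class[].
  move=> x Xx; exists (reflection x); last exact: reflectionK.
  by case: (reflection_trace_class Xx).
- by move=> x /reflection_trace_class[].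
- by move=> x _; exact: reflectionK.
rewrite closed_span_face diamond_compl_face; split.
- exact: corner_subspace.
- by split=> [|c x y -> ->]; rewrite ?scaler0 ?addr0.
- apply/seteqP; split=> [x [] //|_ ->].
  by split=> //; exact: corner_subspace.1.
apply/seteqP; split=> [x /reflection_fixed cx|_ [x cx [_ -> <-]]].
  by exists x => //; exists 0 => //; rewrite addr0.
by apply/reflection_fixed; rewrite addr0.
Qed.

(** Ensures that the claim about all families of Peirce projections of this face is not vacuous. *)
Lemma peirce_projections_exist : peirce_projections X N face
  (fun k x => if k is 0 then 0 else if k is 1 then 2^-1 *: (x - reflection x)
              else P \o x).
Proof.
exists reflection; first exact: reflection_symmetry.
split=> //.
- rewrite closed_span_face; split.
  + move=> c x y _ _; apply: funext => z.
    by rewrite -[LHS]/(P (c *: x z + y z)) bop_P.1.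
  + apply/seteqP; split=> [_ [x Xx <-]|x cx]; first exact: corner_comp.
    by exists x; [exact: cx.1|exact: cx.2].
  + by move=> x _; apply: funext => z; exact: PK.
- rewrite diamond_compl_face; split=> //.
  + by move=> c x y _ _; rewrite scaler0 addr0.
  + apply/seteqP; split=> [_ [x _ <-] //|_ ->].
    by exists 0 => //; exact: (trace_class0 dotE he).1.
move=> x Xx; rewrite addr0; apply: funext => z.
rewrite -[RHS]/(2^-1 *: (x z + (2 *: P (x z) - x z))) addrC subrK scalerA.
by rewrite mulVf ?pnatr_eq0 // scale1r.
Qed.

(* If [S y = - y] and [y = p + q] with [p = P y], then applying [S] and
   [reflection] alternately shows that [N (2 n p + q)] does not depend on [n],
   so [p = 0]. *)
Lemma symmetry_anti S y : is_symmetry X N face S -> X y -> S y = - y ->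
  P \o y = 0.
Proof.
move=> [lS _ iS _ [_ _ _ fixE]] Xy Sy; have ss := trace_class_subspace dotE he.
pose p : H -> H := P \o y; pose q := y - p.
have cp : corner p := corner_comp Xy.
have Xq : X q := subspaceB ss Xy cp.1.
have Sp : S p = p.
  suff : [set x | X x /\ S x = x] p by case.
  rewrite fixE closed_span_face diamond_compl_face.
  by exists p => //; exists 0 => //; rewrite addr0.
have rp : reflection p = p by have [] := (reflection_fixed p).2 cp.
have rq : reflection q = - q.
  apply: funext => z; rewrite -[RHS]/(- (y z - P (y z))).
  by rewrite -[LHS]/(2 *: P (y z - P (y z)) - (y z - P (y z))) (linB bop_P.1) PK subrr scaler0 add0r.
(* [S] sends [c p + y] to [c p - y = (c - 1) p - q], and the reflection then changes the sign of
   [q]. *)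
have step c : N ((c + 1) *: p + q) = N ((c - 1) *: p + q).
  have Xc : X ((c - 1) *: p - q).
    by apply: subspaceB => //; apply: subspaceZ => //; exact: cp.1.
  rewrite (_ : (c + 1) *: p + q = c *: p + y); last first.
    by rewrite scalerDl scale1r -addrA [p + q]addrC subrK.
  rewrite -iS; last by apply: ss.2 => //; exact: cp.1.
  rewrite lS ?Sp ?Sy //; last exact: cp.1.
  rewrite (_ : c *: p - y = (c - 1) *: p - q); last first.
    by rewrite /q opprB scalerBl scale1r addrA subrK.
  rewrite -(reflection_trace_class Xc).2; congr N.
  by rewrite -[- q]scaleN1r addrC reflectionDZ rq scaleN1r opprK addrC -[(c - 1) *: p]addr0
    reflectionDZ rp (_ : reflection 0 = 0) //; apply: funext => z; rewrite /reflection (lin0 bop_P.1) scaler0 subr0.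
have periodic n : N ((n.*2)%:R *: p + q) = N q.
  elim: n => [|n IH]; first by rewrite scale0r add0r.
  rewrite -IH doubleS; have := step (n.*2.+1)%:R.
  by rewrite natr1 -[X in (X - 1) *: p]natr1 addrK.
apply: trace_norm_eq0; first exact: cp.1.
apply/eqP; rewrite eq_le trace_norm_ge0 ?andbT //; last exact: cp.1.
rewrite leNgt; apply/negP => p0.
pose n := Num.bound (N q / N p).
have nb : N q < n%:R * N p.
  by rewrite -ltr_pdivrMr // /n; have := archi_boundP (divr_ge0 (trace_norm_ge0 dotE he Xq) (ltW p0)).
have : N ((n.*2)%:R *: p) <= N q + N q.
  rewrite -{1}(periodic n) -[X in N X <= _](addrK q).
  rewrite (le_trans (trace_normD dotE he _ _)) //.
  - by apply: subspaceD => //; apply: subspaceZ => //; exact: cp.1.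
  - by rewrite -scaleN1r; exact: subspaceZ.
  by rewrite trace_normN.
rewrite trace_normZ; last exact: cp.1.
rewrite -(rmorph_nat (real_complex R)) cabs_real normr_nat -addnn natrD.
by have := trace_norm_ge0 dotE he Xq; lra.
Qed.

(** With [y = (x - S x) / 2], [S y = - y] forces [P y = 0], while [x - y] is fixed by [S] and so
    lies in the corner. Hence [P x = x - y]. *)
Lemma peirce1_unique Q x : peirce_projections X N face Q -> X x ->
  Q 1%N x = x - (P \o x).
Proof.
move=> [S hS [Q1 _ _ _]] Xx; have ss := trace_class_subspace dotE he.
have [lS [SX _] iS SK [_ _ _ fixE]] := hS; rewrite Q1 //.
have XSx : X (S x) := SX _ Xx; set y := 2^-1 *: (x - S x).
have Xxy : X (x - S x) by exact: subspaceB.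
have half a : 2^-1 *: (a + a) = a :> (H -> H).
  by rewrite scalerDr -scalerDl (_ : 2^-1 + 2^-1 = 1) ?scale1r //; field.
have SB a b : X a -> X b -> S (a - b) = S a - S b.
  by move=> Xa Xb; rewrite [a - b]addrC -(scaleN1r b) lS // scaleN1r addrC.
have S0 : S 0 = 0 by have := SB x x Xx Xx; rewrite !subrr.
have SZ c a : X a -> S (c *: a) = c *: S a.
  by move=> Xa; rewrite -[c *: a]addr0 lS // ?S0 ?addr0 //; exact: (trace_class0 dotE he).1.
have Sy : S y = - y by rewrite /y SZ // SB // SK // -scalerN opprB.
have Xy : X y by exact: subspaceZ.
have Py := symmetry_anti hS Xy Sy.
have xy : x - y = 2^-1 *: (x + S x).
  by rewrite -{1}(half x) /y -scalerBr opprB [S x - x]addrC addrA addrK.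
have cxy : corner (x - y).
  suff : [set z | X z /\ S z = z] (x - y).
    rewrite fixE closed_span_face diamond_compl_face => -[a ca [_ ->]].
    by rewrite addr0 => <-.
  split; first exact: subspaceB.
  have XD := subspaceD ss Xx XSx.
  have SD := lS 1 _ _ Xx XSx; rewrite !scale1r SK // in SD.
  rewrite xy SZ //; exact: (congr1 (fun a => 2^-1 *: a) (etrans SD (addrC _ _))).
rewrite -[in LHS](subKr x y); congr (_ - _); apply: funext => z.
rewrite /= -(subrK (y z) (x z)) (linD hvs.1) (linD hv.1).
rewrite -[v (vs (y z))]/((P \o y) z) Py addr0.
by rewrite -[v _]/(P ((x - y) z)) (cornerP _ cxy).
Qed.

End Isometry.
End Face.

(** * The subspace *)

Section FiniteRank.
Context {R : realType} {H : completeNormedModType R[i]}.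

Lemma finite_rank_subspace : linear_subspace (@finite_rank R H).
Proof.
split.
  split; first exact: bop_bounded bop0.
  exists 0%N, (fun=> 0) => _ [z _ <-].
  exact: (linear_span_subspace _).1.
move=> c x y [bx [m [a ha]]] [by_ [n [b hb]]].
split; first exact: bounded_operatorDZ.
exists (m + n)%N.
exists (fun i => match fintype.split i with inl j => a j | inr j => b j end).
set f := (X in linear_span (range X)) => _ [z _ <-].
have af : linear_span (range a) `<=` linear_span (range f).
  apply: linear_span_sub; first exact: linear_span_subspace.
  move=> _ [j _ <-]; apply: sub_linear_span; exists (lshift n j) => //.
  by rewrite /f (unsplitK (inl j)).
have bf : linear_span (range b) `<=` linear_span (range f).
  apply: linear_span_sub; first exact: linear_span_subspace.
  move=> _ [j _ <-]; apply: sub_linear_span; exists (rshift m j) => //.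
  by rewrite /f (unsplitK (inr j)).
apply: (linear_span_subspace _).2; first by apply: af; apply: ha; exists z.
by apply: bf; apply: hb; exists z.
Qed.

Variable dot : {dot H for (@Num.conj R[i])}.

(** A linear dependence among the [f i], paired with [f j], loses all terms but its [j]-th
    coefficient. *)
Lemma orthonormal_not_spanned f n (b : 'I_n -> H) : orthonormal_seq dot f ->
  ~ forall i, linear_span (range b) (f i).
Proof.
move=> fo /span_dependent[c [[j cj] c0]]; move/eqP: cj; apply.
have := congr1 (fun x => dot x (f j)) c0; rewrite (dot0l dot) (dot_suml dot).
rewrite (bigD1 j) //= (dotZl dot) fo eqxx mulr1 big1 ?addr0 // => i ij.
by rewrite (dotZl dot) fo (negbTE (ij : nat_of_ord i != j)) mulr0.
Qed.

Lemma finite_rank_eigen T f (l : nat -> R[i]) : orthonormal_seq dot f ->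
  finite_rank T -> (forall i, T (f i) = l i *: f i) ->
  ~ forall i, l i != 0.
Proof.
move=> fo [[lT _] [n [b hb]]] hT l0; apply: (orthonormal_not_spanned fo (b := b)).
move=> i; rewrite -[f i]scale1r -(mulVf (l0 i)) -scalerA -hT.
by apply: (subspaceZ (linear_span_subspace _)); apply: hb; exists (f i).
Qed.

End FiniteRank.

Theorem proposition4p7 (R : realType) (H : completeNormedModType R[i])
    (dot : {dot H for (@Num.conj R[i])})
    (dotE : forall x : H, `|x| ^+ 2 = dot x x)
    (sepH : separable H) (infH : infinite_dimensional H) :
  exists Z : set (H -> H),
    [/\ linear_subspace Z,
        finite_rank `<=` Z /\ Z `<=` trace_class dot,
        trace_class dot `<=` norm_closure (trace_class dot) (trace_norm dot) Z &
        exists (F : set (H -> H)) (k : nat),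
          [/\ norm_exposed_face (trace_class dot) (trace_norm dot) F,
              (k <= 2)%N,
              exists P : nat -> (H -> H) -> (H -> H),
                peirce_projections (trace_class dot) (trace_norm dot) F P &
              forall P : nat -> (H -> H) -> (H -> H),
                peirce_projections (trace_class dot) (trace_norm dot) F P ->
                ~ (P k @` Z `<=` Z)]].
Proof.
have he : orthonormal_basis dot (trace_basis dot).
  have [e he] := orthonormal_basis_exists dotE sepH infH.
  by rewrite /trace_basis; case: xgetP => // /(_ e).
set e := trace_basis dot in he *; have eo := he.1.
have [x bx xE] := diag_exists dotE he eo (@weight_le1 R).
have [Xx _] := trace_class_diag dotE he eo bx xE.
(* The even vectors will span the range of [P], the odd ones lie in its kernel. *)
have fo : orthonormal_seq dot (fun i => e i.*2).
  by move=> i j; rewrite eo -!muln2 eqn_pmul2r.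
have fo' : orthonormal_seq dot (fun i => e i.*2.+1).
  by move=> i j; rewrite eo eqSS -!muln2 eqn_pmul2r.
have [v hv vE] : exists2 v, bop 1 v & forall i, v (e i) = e i.*2.
  have [|v hv vE] := diag_exists dotE he (d := fun=> 1) fo.
    by rewrite cabs1.
  by exists v => // i; rewrite vE scale1r.
have [vs hvs adj] := adjoint_exists dotE he ler01 hv.
have vK z : vs (v z) = z.
  apply: (congr1 (fun f => f z)
    (bop_ext dotE he (bop_comp ler01 hvs hv) bop_id _ : vs \o v = id)) => i /=.
  apply: (basis_ext dotE he) => j.
  by rewrite (dotC dot) -adj -(dotC dot) !vE fo eo.
have vs_odd i : vs (e i.*2.+1) = 0.
  apply: (basis_orth dotE he) => j; rewrite (dotC dot) -adj -(dotC dot) vE eo.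
  by case: eqP => // /(congr1 odd); rewrite /= !odd_double.
pose Z := [set y | exists2 f, finite_rank f & exists c : R[i], y = f + c *: x].
have [fr0 frD] := @finite_rank_subspace R H.
have frZ : finite_rank `<=` Z.
  by move=> f hf; exists f => //; exists 0; rewrite scale0r addr0.
have Zx : Z x by exists 0 => //; exists 1; rewrite scale1r add0r.
exists Z; split.
- split; first exact: frZ.
  move=> c _ _ [f hf [a ->]] [g hg [b ->]].
  exists (c *: f + g); first exact: frD.
  by exists (c * a + b); rewrite scalerDr addrACA scalerA scalerDl.
- split=> // _ [f hf [c ->]].
  apply: (subspaceD (trace_class_subspace dotE he)).
    exact: trace_class_finite_rank.
  exact: (subspaceZ (trace_class_subspace dotE he)).
- move=> y Xy; split=> // d d0.
  have [m hm] := trace_norm_bproj dotE he Xy (divr_gt0 d0 (ltr0Sn R 1)).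
  exists (y \o bproj dot e m).
    by apply: frZ; apply: (finite_rank_bproj dotE he m); exact: Xy.1.
  by rewrite (le_lt_trans hm) // ltr_pdivrMr // ltr_pMr // ltr1n.
exists (face dot v), 1%N; split=> //.
- exact: (norm_exposed_face_face dotE he hv adj vK).
- by eexists; exact: (peirce_projections_exist dotE he hv hvs adj vK).
move=> Q hQ QZ; have : Z (Q 1%N x) by apply: QZ; exists x.
rewrite (peirce1_unique dotE he hv hvs adj vK hQ Xx) => -[f hf [c fE]].
have fx z : f z = x z - v (vs (x z)) - c *: x z.
  by rewrite -[LHS](addrK (c *: x z)) -[f z + _]/((f + c *: x) z) -fE.
have w0 i : (weight i)%:C != 0 :> R[i].
  by rewrite eq_complex /= negb_and lt0r_neq0 // weight_gt0.
(* For [c = 0] the odd basis vectors are eigenvectors of [f] with nonzero eigenvalues; for [c != 0]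
   the even ones are, since [P] fixes them and only [- c x] remains. *)
have [c0|c0] := eqVneq c 0.
  apply: (finite_rank_eigen fo' hf (l := fun i => (weight i.*2.+1)%:C)) => // i.
  rewrite fx c0 scale0r subr0 xE (linZ hvs.1) (linZ hv.1) vs_odd (lin0 hv.1).
  by rewrite scaler0 subr0.
apply: (finite_rank_eigen fo hf (l := fun i => - (c * (weight i.*2)%:C))) => i.
  rewrite fx xE (linZ hvs.1) (linZ hv.1) -vE vK subrr sub0r scaleNr scalerA.
  by [].
by rewrite oppr_eq0 mulf_neq0.
Qed.
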